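(* Let $\mathcal{C}$ be a nonzero integer and let $J$ be a constant real $2\times 2$ matrix with $J^2=-1$. Geometrically flat (anti-)Kähler bands with Chern number $\mathcal{C}$ and complex structure $J$ are unique up to a gauge choice. Precisely: let $(|u_{\mathbf{k}}\rangle)_{\mathbf{k}\in\mathbb{R}^2}\subset\mathcal{H}$ and $(|u'_{\mathbf{k}}\rangle)_{\mathbf{k}\in\mathbb{R}^2}\subset\mathcal{H}'$ be two Bloch bands, both with Chern number $\mathcal{C}$, such that for each of the two bands the quantum metric $g$ and the Berry curvature $F$ satisfy $$g(\mathbf{k})=-\frac{i}{2}F(\mathbf{k})\,J\quad\text{for all }\mathbf{k}\in\mathbb{R}^2,$$ and $g(\mathbf{k})$ is independent of $\mathbf{k}$. Then there exist a unitary isomorphism $$W:\overline{\mathrm{span}}\{|u_{\mathbf{k}}\rangle:\mathbf{k}\in\mathbb{R}^2\}\to\overline{\mathrm{span}}\{|u'_{\mathbf{k}}\rangle:\mathbf{k}\in\mathbb{R}^2\}$$ and a smooth function $\lambda:\mathbb{R}^2\to\mathbb{C}\setminus\{0\}$ such that $$|u'_{\mathbf{k}}\rangle=\lambda(\mathbf{k})\,W|u_{\mathbf{k}}\rangle\quad\text{for all }\mathbf{k}\in\mathbb{R}^2.$$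
   Context: Bloch bands. The Brillouin zone is the torus $\mathbb{R}^2/\mathbb{Z}^2$ with coordinates $\mathbf{k}=(k_1,k_2)=(k_x,k_y)$. A Bloch band consists of a fixed complex (separable) Hilbert space $\mathcal{H}$, of finite or infinite dimension, and a smooth family of nonzero vectors $|u_{\mathbf{k}}\rangle\in\mathcal{H}$, $\mathbf{k}\in\mathbb{R}^2$, such that there are $\mathbf{k}$-independent unitary or anti-unitary operators $V_{\mathbf{G}}$ on $\mathcal{H}$, $\mathbf{G}\in\mathbb{Z}^2$, with $V_{\mathbf{G}_1+\mathbf{G}_2}$ equal to $V_{\mathbf{G}_1}V_{\mathbf{G}_2}$ up to a phase depending on $\mathbf{G}_1,\mathbf{G}_2$, and smooth functions $e_{\mathbf{G}}:\mathbb{R}^2\to\mathbb{C}\setminus\{0\}$, satisfying $$|u_{\mathbf{k}+\mathbf{G}}\rangle=(V_{\mathbf{G}}|u_{\mathbf{k}}\rangle)\,e_{\mathbf{G}}(\mathbf{k}),\qquad \mathbf{k}\in\mathbb{R}^2,\ \mathbf{G}\in\mathbb{Z}^2.$$ Vectors need not be normalized. The quantum state at $\mathbf{k}$ is the line spanned by $|u_{\mathbf{k}}\rangle$; multiplying $|u_{\mathbf{k}}\rangle$ by a smooth nowhere-vanishing complex function of $\mathbf{k}$ is a gauge transformation. Inner products are conjugate-linear in the first argument. Quantum metric: $g(\mathbf{k})=[g_{ij}(\mathbf{k})]_{1\le i,j\le 2}$ with, writing $\partial_i=\partial/\partial k_i$ and $u=u_{\mathbf{k}}$, $$g_{ij}=\mathrm{Re}\left(\frac{\langle\partial_i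 u|\partial_j u\rangle}{\langle u|u\rangle}-\frac{\langle\partial_i u|u\rangle\langle u|\partial_j u\rangle}{\langle u|u\rangle^2}\right).$$ Berry curvature (purely imaginary convention): $F(\mathbf{k})=[F_{ij}(\mathbf{k})]_{1\le i,j\le 2}$, $F_{ij}=\partial_iA_j-\partial_jA_i$, with $A_i=\langle u|\partial_i u\rangle/\langle u|u\rangle$. Both $g$ and $F$ are gauge-invariant. Chern number: $\mathcal{C}=\frac{1}{2\pi i}\int_{[0,1]^2}F_{12}(\mathbf{k})\,dk_1dk_2$. With this sign convention $\mathcal{C}>0$ corresponds to Kähler bands (where $J$ induces the standard orientation of $\mathbb{R}^2$, so that $J=\frac{1}{\mathrm{Im}\,\tau}\begin{pmatrix}-\mathrm{Re}\,\tau&-|\tau|^2\\1&\mathrm{Re}\,\tau\end{pmatrix}$ for some $\tau\in\mathbb{C}$ with $\mathrm{Im}\,\tau>0$) and $\mathcal{C}<0$ corresponds to anti-Kähler bands (where $J$ induces the opposite orientation). *)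

(* Defs.v *)
From HB Require Import structures.
From mathcomp Require Import all_boot all_order all_algebra.
From mathcomp Require Import complex.
From mathcomp Require Import all_classical all_reals all_analysis.

Set Implicit Arguments.
Unset Strict Implicit.
Unset Printing Implicit Defensive.

Import Order.TTheory GRing.Theory Num.Theory.
Import numFieldNormedType.Exports.

Local Open Scope classical_set_scope.
Local Open Scope ring_scope.
Local Open Scope complex_scope.

(** Complex Hilbert spaces.  The underlying library structure is a complete
    normed space over the real scalars R, so that the library's derivatives of
    vector-valued functions of real variables apply as they are; the complex
    scalar multiplication [hscale] extends the real one, and the inner product
    (conjugate-linear in its first argument) induces the norm. *)
HB.mixin Record CompleteNormedModule_isHilbert (R : realType) H
    of CompleteNormedModule R H := {
  hscale : R[i] -> H -> H ;
  hdot : H -> H -> R[i] ;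
  hscale_real : forall (r : R) (x : H), hscale r%:C x = r *: x ;
  hscaleA : forall (a b : R[i]) (x : H), hscale a (hscale b x) = hscale (a * b) x ;
  hscaleDl : forall (a b : R[i]) (x : H), hscale (a + b) x = hscale a x + hscale b x ;
  hscaleDr : forall (a : R[i]) (x y : H), hscale a (x + y) = hscale a x + hscale a y ;
  hdotDr : forall x y z : H, hdot x (y + z) = hdot x y + hdot x z ;
  hdotZr : forall (a : R[i]) (x y : H), hdot x (hscale a y) = a * hdot x y ;
  hdot_conj : forall x y : H, hdot x y = (hdot y x)^* ;
  hdot_norm : forall x : H, hdot x x = (`|x| ^+ 2)%:C
}.

#[short(type="hilbertType")]
HB.structure Definition Hilbert (R : realType) :=
  { H of CompleteNormedModule R H & CompleteNormedModule_isHilbert R H }.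

Definition separable_space (T : topologicalType) : Prop :=
  exists s : nat -> T, dense (range s).

Definition unitary_op (R : realType) (H : hilbertType R) (V : H -> H) : Prop :=
  [/\ {morph V : x y / x + y},
      forall (a : R[i]) (x : H), V (hscale a x) = hscale a (V x),
      forall x y : H, hdot (V x) (V y) = hdot x y
    & forall y : H, exists x : H, V x = y].

Definition antiunitary_op (R : realType) (H : hilbertType R) (V : H -> H) : Prop :=
  [/\ {morph V : x y / x + y},
      forall (a : R[i]) (x : H), V (hscale a x) = hscale a^* (V x),
      forall x y : H, hdot (V x) (V y) = (hdot x y)^*
    & forall y : H, exists x : H, V x = y].

Definition complex_span (R : realType) (H : hilbertType R) (A : set H) : set H :=
  [set x | exists (n : nat) (a : 'I_n -> R[i]) (v : 'I_n -> H),
     (forall i, A (v i)) /\ x = \sum_(i < n) hscale (a i) (v i)].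

Definition closed_span (R : realType) (H : hilbertType R) (A : set H) : set H :=
  closure (complex_span A).

(* W is given as a function on all of H, but only its restriction to the
   subspace S is constrained. *)
Definition unitary_iso (R : realType) (H H' : hilbertType R)
    (S : set H) (S' : set H') (W : H -> H') : Prop :=
  [/\ set_bij S S' W,
      forall x y : H, S x -> S y -> W (x + y) = W x + W y,
      forall (a : R[i]) (x : H), S x -> W (hscale a x) = hscale a (W x)
    & forall x y : H, S x -> S y -> hdot (W x) (W y) = hdot x y].

(** Calculus on the plane, whose points are pairs k = (k_1, k_2); the
    coordinate labelled 1 (resp. 2) has index 0 (resp. 1) in 'I_2. *)
Definition axis (R : realType) (i : 'I_2) : R * R := ((i == 0)%:R, (i == 1)%:R).

Definition partial (R : realType) (V : normedModType R) (i : 'I_2)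
    (f : R * R -> V) : R * R -> V :=
  fun k => 'D_(axis R i) f k.

(* C^oo: every iterated partial derivative exists and is differentiable. *)
Definition smooth (R : realType) (V : normedModType R) (f : R * R -> V) : Prop :=
  forall (s : seq 'I_2) (k : R * R), differentiable (foldr (@partial R V) f s) k.

(* R[i] carries no normed module structure over R in the library, hence the
   componentwise definitions for complex-valued functions. *)
Definition csmooth (R : realType) (f : R * R -> R[i]) : Prop :=
  smooth (fun k => complex.Re (f k)) /\ smooth (fun k => complex.Im (f k)).

Definition cpartial (R : realType) (i : 'I_2) (f : R * R -> R[i]) :
    R * R -> R[i] :=
  fun k => partial i (fun q => complex.Re (f q)) k
           +i* partial i (fun q => complex.Im (f q)) k.

Definition cintegral (R : realType) (D : set (R * R)) (f : R * R -> R[i]) : R[i] :=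
  Rintegral (lebesgue_measure \x lebesgue_measure)%E D (fun k => complex.Re (f k))
  +i* Rintegral (lebesgue_measure \x lebesgue_measure)%E D (fun k => complex.Im (f k)).

Definition lattice (R : realType) (G : int * int) : R * R := (G.1%:~R, G.2%:~R).

Record bloch_band (R : realType) (H : hilbertType R) (u : R * R -> H) : Prop := {
  bloch_separable : separable_space H ;
  bloch_smooth : smooth u ;
  bloch_neq0 : forall k, u k != 0 ;
  bloch_periodic :
    exists (V : int * int -> H -> H) (e : int * int -> R * R -> R[i]),
      [/\ forall G, unitary_op (V G) \/ antiunitary_op (V G),
          forall G1 G2, exists c : R[i], `|c| = 1 /\
            forall x : H, V (G1 + G2) x = hscale c (V G1 (V G2 x)),
          forall G, csmooth (e G) /\ (forall k, e G k != 0)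
        & forall G k, u (k + lattice R G) = hscale (e G k) (V G (u k))] }.

Section BandGeometry.
Context (R : realType) (H : hilbertType R) (u : R * R -> H).

Definition quantum_metric (k : R * R) : 'M[R]_2 :=
  \matrix_(i, j) complex.Re
    (hdot (partial i u k) (partial j u k) / hdot (u k) (u k)
     - hdot (partial i u k) (u k) * hdot (u k) (partial j u k)
       / hdot (u k) (u k) ^+ 2).

Definition berry_connection (i : 'I_2) (k : R * R) : R[i] :=
  hdot (u k) (partial i u k) / hdot (u k) (u k).

Definition berry_curvature (k : R * R) : 'M[R[i]]_2 :=
  \matrix_(i, j) (cpartial i (berry_connection j) k
                  - cpartial j (berry_connection i) k).

Definition chern_number : R[i] :=
  (2 * pi%:C * 'i%C)^-1
  * cintegral (`[0, 1] `*` `[0, 1]) (fun k => berry_curvature k 0 1).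

Definition kahler_wrt (J : 'M[R]_2) : Prop :=
  forall k, map_mx (real_complex R) (quantum_metric k)
            = (- ('i%C / 2)) *: (berry_curvature k *m map_mx (real_complex R) J).

Definition geometrically_flat : Prop :=
  forall k k', quantum_metric k = quantum_metric k'.

End BandGeometry.

(* Main.v *)
Require Import Defs.
From HB Require Import structures.
From mathcomp Require Import all_boot all_order all_algebra.
From mathcomp Require Import complex.
From mathcomp Require Import all_classical all_reals all_analysis.
From mathcomp Require Import ring lra.

(** In the coordinate z = k_1 + tau k_2 of the complex structure J, the Kaehler
    identity says that the covariant d/dzbar annihilates u, and flatness together
    with the Chern number fixes the curvature, i.e. the commutator c of the
    covariant derivatives.  These then form a Heisenberg algebra with u as lowest
    state: the iterated covariant d/dz-derivatives f_n of u are pointwise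
    orthogonal, of squared norm n! c^n |u|^2.  Hence the Taylor sums
    S_n = sum_(m < n) (z_p - z)^m / m! f_m carry u_p to any other point up to
    a gauge and Gaussian factor, with an error of order sqrt(r^n / n!), and pairing
    them with u_q at q gives
      |<u_p, u_q>|^2 = |u_p|^2 |u_q|^2 exp(- c |z_p - z_q|^2).
    The right-hand side is the same for both bands, so the quotient
      <u'_p, u'_q> <u_0, u_q> / (<u_p, u_q> <u'_0, u'_q>)
    is holomorphic in q with constant modulus, hence constant.  This factors
    <u'_p, u'_q> / <u_p, u_q> as conj(lambda p) lambda(q), so u' / lambda and u
    have the same Gram kernel, which determines a family up to a unitary. *)

Set Implicit Arguments.
Unset Strict Implicit.
Unset Printing Implicit Defensive.

Import Order.TTheory GRing.Theory Num.Theory.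
Import numFieldNormedType.Exports.

Local Open Scope classical_set_scope.
Local Open Scope ring_scope.
Local Open Scope complex_scope.

(** * Smooth functions on the plane *)

Section Calculus.
Context {R : realType}.
Implicit Types (U V W : normedModType R) (k : R * R) (i : 'I_2).

(** The vectors come in an arbitrary gauge and are only known to be smooth. A holomorphic gauge
    would require solving a d-bar equation, and an infinite Taylor series would require analyticity;
    both are avoided. The components [alpha] and [beta] of the Berry connection stay in every
    identity and cancel only in gauge-invariant ratios. The series is truncated: along the segment
    from p to q the normalized overlap with the n-th sum varies by at most a constant over 2^n,
    while its two end values do not depend on n. A Gaussian never vanishes, so the overlap formula
    also provides the nonzero denominators needed to define the gauge factor. Both orientations are
    handled at once: Im tau has the sign of [J 1 0], and only Im tau <> 0 enters, so an anti-Kähler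
    band is treated with tau in the lower half-plane. *)

Lemma partialE V i (f : R * R -> V) k :
  differentiable f k -> partial i f k = 'd f k (axis R i).
Proof. by move=> df; rewrite /partial deriveE. Qed.

(** The recursion peels off the derivative applied first, so a product rule for [partial i] reduces
    order n + 1 to order n; [foldr] in [smooth] peels off the one applied last. *)
Fixpoint smooth_upto n V (f : R * R -> V) : Prop :=
  (forall k, differentiable f k) /\
  (if n is m.+1 then forall i, smooth_upto m (partial i f) else True).

Lemma smooth_uptoW n V (f : R * R -> V) k :
  smooth_upto n f -> differentiable f k.
Proof. by case: n => [|n] []. Qed.

Lemma smooth_uptoS n V (f : R * R -> V) : smooth_upto n.+1 f -> smooth_upto n f.
Proof.
elim: n V f => [|n IH] V f [df pf]; split => // i.
exact/IH/pf.
Qed.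

Lemma smooth_partial V i (f : R * R -> V) : smooth f -> smooth (partial i f).
Proof. by move=> sf s k; have := sf (rcons s i) k; rewrite foldr_rcons. Qed.

Lemma smoothP V (f : R * R -> V) : smooth f <-> forall n, smooth_upto n f.
Proof.
split=> [sf n|sf s k].
  elim: n V f sf => [|n IH] V f sf; split => //; try exact: (sf [::]).
  by move=> i; apply: IH; exact: smooth_partial.
suff : forall m, smooth_upto m (foldr (@partial R V) f s).
  by move=> /(_ 0%N) [].
elim: s => [//|i s IH] m /=.
by have [_ /(_ i)] := IH m.+1.
Qed.

Lemma smooth_diff V (f : R * R -> V) k : smooth f -> differentiable f k.
Proof. by move=> sf; exact: (sf [::]). Qed.

Lemma eq_smooth_upto n V (f g : R * R -> V) :
  f =1 g -> smooth_upto n f -> smooth_upto n g.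
Proof. by move=> /funext ->. Qed.

Lemma smooth_upto_cst n V (a : V) : smooth_upto n (fun _ : R * R => a).
Proof.
elim: n a => [|n IH] a; split => //; try by move=> k; exact: differentiable_cst.
move=> i; rewrite (_ : partial i _ = fun=> 0); first exact: IH.
by apply/funext => k; rewrite /partial derive_cst.
Qed.

Lemma partialD V i (f g : R * R -> V) k :
  differentiable f k -> differentiable g k ->
  partial i (fun k => f k + g k) k = partial i f k + partial i g k.
Proof. by move=> df dg; rewrite /partial deriveD //; exact: diff_derivable. Qed.

Lemma smooth_uptoD n V (f g : R * R -> V) :
  smooth_upto n f -> smooth_upto n g -> smooth_upto n (fun k => f k + g k).
Proof.
elim: n f g => [|n IH] f g [df pf] [dg pg]; split => //;
  try by move=> k; exact: differentiableD.
move=> i; apply: eq_smooth_upto (IH _ _ (pf i) (pg i)) => k.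
by rewrite partialD.
Qed.

Section Linear.
Context V W (L : {linear V -> W}) (Lc : continuous L).

Lemma differentiable_linear (f : R * R -> V) k :
  differentiable f k -> differentiable (fun k => L (f k)) k.
Proof.
by move=> df; apply: differentiable_comp => //; exact: linear_differentiable.
Qed.

Lemma partial_linear i (f : R * R -> V) k :
  differentiable f k -> partial i (fun k => L (f k)) k = L (partial i f k).
Proof.
move=> df; rewrite !partialE //; last exact: differentiable_linear.
have dL := linear_differentiable (f k) Lc.
by rewrite (diff_comp df) //= diff_lin.
Qed.

Lemma smooth_upto_linear n (f : R * R -> V) :
  smooth_upto n f -> smooth_upto n (fun k => L (f k)).
Proof.
elim: n f => [|n IH] f [df pf]; split => //;
  try by move=> k; exact: differentiable_linear.
by move=> i; apply: eq_smooth_upto (IH _ (pf i)) => k; rewrite partial_linear.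
Qed.

End Linear.

Section Bilinear.
Context U V W (B : U -> V -> W).
Context (Bl : bilinear_for (GRing.Scale.Law.clone _ _ *:%R _)
                           (GRing.Scale.Law.clone _ _ *:%R _) B).
Context (Bc : continuous (fun p : U * V => B p.1 p.2)).

Lemma is_diff_bilinear p :
  is_diff p (fun q => B q.1 q.2) (fun q => B p.1 q.2 + B q.1 p.2).
Proof.
pose bB := bilinear_isBilinear.Build _ _ _ _ _ _ _ Bl.
pose B' : {bilinear U -> V -> W} := HB.pack B bB.
split; first exact: (differentiable_bilin (f := B')).
exact: (diff_bilin (f := B')).
Qed.

Lemma differentiable_bilinear (f : R * R -> U) (g : R * R -> V) k :
  differentiable f k -> differentiable g k ->
  differentiable (fun k => B (f k) (g k)) k.
Proof.
move=> df dg.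
apply: (@differentiable_comp _ _ _ _ (fun k => (f k, g k)) (fun q => B q.1 q.2)).
  exact: differentiable_pair.
by have [] := is_diff_bilinear (f k, g k).
Qed.

(** One product rule covers the product of reals, real scaling and the real inner product [rdot];
    hence [B] is an arbitrary continuous bilinear map. *)
Lemma partial_bilinear i (f : R * R -> U) (g : R * R -> V) k :
  differentiable f k -> differentiable g k ->
  partial i (fun k => B (f k) (g k)) k
  = B (partial i f k) (g k) + B (f k) (partial i g k).
Proof.
move=> df dg; rewrite !partialE //; last exact: differentiable_bilinear.
have [dB eB] := is_diff_bilinear (f k, g k).
rewrite (@diff_comp _ _ _ _ (fun k => (f k, g k)) (fun q => B q.1 q.2)) //.
  rewrite eB /= diff_pair //= addrC //.
exact: differentiable_pair.
Qed.

Lemma smooth_upto_bilinear n (f : R * R -> U) (g : R * R -> V) :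
  smooth_upto n f -> smooth_upto n g -> smooth_upto n (fun k => B (f k) (g k)).
Proof.
have dB n' f' g' : smooth_upto n' f' -> smooth_upto n' g' ->
    forall k, differentiable (fun k => B (f' k) (g' k)) k.
  move=> sf sg k; apply: differentiable_bilinear; [exact: smooth_uptoW sf|].
  exact: smooth_uptoW sg.
elim: n f g => [|n IH] f g sf sg; split => //; try exact: dB sf sg.
move=> i; have [df pf] := sf; have [dg pg] := sg.
apply: eq_smooth_upto (smooth_uptoD (IH _ _ (pf i) (smooth_uptoS sg))
  (IH _ _ (smooth_uptoS sf) (pg i))) => k.
by rewrite partial_bilinear.
Qed.

End Bilinear.

Lemma scale_bilinear V :
  bilinear_for (GRing.Scale.Law.clone _ _ *:%R _)
    (GRing.Scale.Law.clone _ _ *:%R _) (fun (a : R) (x : V) => a *: x).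
Proof.
split=> [x|a] b y z /=; first by rewrite scalerDl scalerA.
by rewrite scalerDr !scalerA mulrC.
Qed.

Lemma mul_bilinear :
  bilinear_for (GRing.Scale.Law.clone _ _ *:%R _)
    (GRing.Scale.Law.clone _ _ *:%R _) (fun a b : R => a * b).
Proof.
split=> [x|a] b y z /=; first by rewrite mulrDl -mulrA.
by rewrite mulrDr /GRing.scale /= !mulrA (mulrC a b).
Qed.

Lemma mul_cont2 : continuous (fun p : R * R => p.1 * p.2).
Proof. exact: (@mul_continuous R). Qed.

Lemma scale_cont2 V : continuous (fun p : R * V => p.1 *: p.2).
Proof. exact: (@scale_continuous R V). Qed.

Lemma partialM i (f g : R * R -> R) k :
  differentiable f k -> differentiable g k ->
  partial i (fun k => f k * g k) k = partial i f k * g k + f k * partial i g k.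
Proof. exact: (partial_bilinear mul_bilinear mul_cont2). Qed.

Lemma smooth_uptoM n (f g : R * R -> R) :
  smooth_upto n f -> smooth_upto n g -> smooth_upto n (fun k => f k * g k).
Proof. exact: (smooth_upto_bilinear mul_bilinear mul_cont2). Qed.

Lemma partialN i (f : R * R -> R) k :
  differentiable f k -> partial i (fun k => - f k) k = - partial i f k.
Proof. by move=> df; rewrite /partial deriveN //; exact: diff_derivable. Qed.

Lemma smooth_uptoN n (f : R * R -> R) :
  smooth_upto n f -> smooth_upto n (fun k => - f k).
Proof.
move=> sf; have := smooth_uptoM (smooth_upto_cst n (-1 : R)) sf.
by apply: eq_smooth_upto => k; rewrite mulN1r.
Qed.

Lemma partialV i (f : R * R -> R) k : differentiable f k -> f k != 0 ->
  partial i (fun k => (f k)^-1) k = - (f k)^-1 * (f k)^-1 * partial i f k.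
Proof.
move=> df f0; rewrite /partial deriveV //; last exact: diff_derivable.
by rewrite /GRing.scale /= expr2 invfM !mulNr.
Qed.

Lemma smooth_uptoV n (f : R * R -> R) : (forall k, f k != 0) ->
  smooth_upto n f -> smooth_upto n (fun k => (f k)^-1).
Proof.
move=> f0; elim: n => [|n IH] sf; split => //;
  try by move=> k; apply: differentiableV => //; exact: smooth_uptoW sf.
move=> i; have [df pf] := sf; have sV := IH (smooth_uptoS sf).
apply: eq_smooth_upto (smooth_uptoM (smooth_uptoM (smooth_uptoN sV) sV) (pf i)) => k.
by rewrite partialV.
Qed.

Lemma differentiable_expR (f : R * R -> R) k :
  differentiable f k -> differentiable (fun k => expR (f k)) k.
Proof.
move=> df; apply: (@differentiable_comp _ _ _ _ f expR) => //.
exact/derivable1_diffP/derivable_expR.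
Qed.

Lemma partial_expR i (f : R * R -> R) k : differentiable f k ->
  partial i (fun k => expR (f k)) k = expR (f k) * partial i f k.
Proof.
move=> df; rewrite !partialE //; last exact: differentiable_expR.
have de : differentiable (@expR R) (f k) by exact/derivable1_diffP/derivable_expR.
have eD : (@expR R)^`()%classic (f k) = expR (f k) by rewrite derive1E; exact: (congr1 (@^~ (f k)) (@derive_expR R)).
rewrite (@diff_comp _ _ _ _ f expR) //= deriv1E; last exact: derivable_expR.
by rewrite eD mulrC.
Qed.

Lemma smooth_upto_expR n (f : R * R -> R) :
  smooth_upto n f -> smooth_upto n (fun k => expR (f k)).
Proof.
elim: n => [|n IH] sf; split => //;
  try by move=> k; apply: differentiable_expR => //; exact: smooth_uptoW sf.
move=> i; have [df pf] := sf.
apply: eq_smooth_upto (smooth_uptoM (IH (smooth_uptoS sf)) (pf i)) => k.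
by rewrite partial_expR.
Qed.

End Calculus.

(** * Mean values on the plane and symmetry of mixed partial derivatives *)

Section MeanValue.
Context {R : realType}.
Implicit Types (f : R * R -> R) (p q k v : R * R) (i j : 'I_2).

Lemma plane_basis v : v = v.1 *: axis R 0 + v.2 *: axis R 1.
Proof.
case: v => a b; congr pair => /=; rewrite /GRing.scale /=.
  by rewrite mulr1 mulr0 addr0.
by rewrite mulr1 mulr0 add0r.
Qed.

Lemma is_derive_segment f p v (t : R) : (forall k, differentiable f k) ->
  is_derive t 1 (fun t : R => f (p + t *: v))
    (v.1 * partial 0 f (p + t *: v) + v.2 * partial 1 f (p + t *: v)).
Proof.
move=> df; set k := p + t *: v.
have dl : is_diff t (fun t : R => p + t *: v) (fun t => 0 + t *: v).
  exact: is_diffD.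
have dc : is_diff t (fun t : R => f (p + t *: v))
    ('d f k \o (fun t => 0 + t *: v)).
  exact: (@is_diff_comp _ _ _ _ (fun t : R => p + t *: v) _ f).
apply: DeriveDef.
  by apply: diff_derivable; apply: ex_diff.
rewrite deriveE; last by apply: ex_diff.
rewrite diff_val /= add0r scale1r [in LHS](plane_basis v) linearD !linearZ /=.
by rewrite !partialE.
Qed.

Lemma mean_value_plane f p q : (forall k, differentiable f k) ->
  exists2 t : R, 0 <= t <= 1 & f q - f p =
    (q - p).1 * partial 0 f (p + t *: (q - p))
    + (q - p).2 * partial 1 f (p + t *: (q - p)).
Proof.
move=> df; pose g t := f (p + t *: (q - p)).
have dg t := is_derive_segment p (q - p) t df.
have cg : {within `[0, 1], continuous g}.
  apply/continuous_subspaceT => t; apply: differentiable_continuous.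
  exact/derivable1_diffP/(@ex_derive _ _ _ _ _ _ _ (dg t)).
have [t t01 e] := MVT_segment ler01 (fun t _ => dg t) cg.
exists t; first by rewrite in_itv in t01.
move: e; rewrite /g scale1r scale0r addr0 subrKC => ->.
by rewrite subr0 mulr1.
Qed.

Lemma partial0_cst f p q : (forall k, differentiable f k) ->
  (forall i k, partial i f k = 0) -> f p = f q.
Proof.
move=> df p0; have [t _] := mean_value_plane p q df.
by rewrite !p0 !mulr0 addr0 => /eqP; rewrite subr_eq0 => /eqP.
Qed.

Lemma mean_value_axis f i p (h : R) : (forall k, differentiable f k) ->
  exists2 t : R, 0 <= t <= 1 &
    f (p + h *: axis R i) - f p = h * partial i f (p + (t * h) *: axis R i).
Proof.
move=> df; have [t t01 ->] := mean_value_plane p (p + h *: axis R i) df.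
exists t => //.
have -> : p + h *: axis R i - p = h *: axis R i by rewrite addrC addKr.
have : i = 0 \/ i = 1.
  by case: i => [[|[|]]] //= ?; [left|right]; apply: val_inj.
rewrite scalerA /=; rewrite /GRing.scale /=.
by case=> ->; rewrite /= !(mulr0, mulr1, mul0r, addr0, add0r).
Qed.

Lemma partial_shift i f p k :
  partial i (fun k => f (k + p)) k = partial i f (k + p).
Proof.
rewrite /partial /derive.
by under eq_fun do rewrite /= -addrA.
Qed.

(** The mean value theorem is applied along i to the increment in direction j, then along j to
    [partial i f]. The left-hand side is symmetric in i and j, so exchanging them equates the two
    mixed partials at nearby points. *)
Lemma second_difference f i j p (h : R) :
  (forall k, differentiable f k) -> (forall k, differentiable (partial i f) k) ->
  exists t s : R, [/\ 0 <= t <= 1, 0 <= s <= 1 &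
    f (p + h *: axis R i + h *: axis R j) - f (p + h *: axis R i)
      - (f (p + h *: axis R j) - f p)
    = h * (h * partial j (partial i f)
                 (p + (t * h) *: axis R i + (s * h) *: axis R j))].
Proof.
move=> df dpf; pose g k := f (k + h *: axis R j) - f k.
have ds k : differentiable (fun k => f (k + h *: axis R j)) k.
  exact: (@differentiable_comp _ _ _ _ (fun k => k + h *: axis R j) f).
have dg k : differentiable g k by apply: differentiableB.
have [t t01 et] := mean_value_axis i p h dg.
have [s s01 es] := mean_value_axis j (p + (t * h) *: axis R i) h dpf.
exists t, s; split => //.
rewrite -es; move: et; rewrite /g => ->; congr (_ * _).
rewrite /partial deriveB; [|exact: diff_derivable..].
by rewrite -/(partial i (fun k => f (k + h *: axis R j)) _) partial_shift.
Qed.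

Lemma schwarz_real f i j k : smooth f ->
  partial i (partial j f) k = partial j (partial i f) k.
Proof.
move=> sf; have df := smooth_diff _ sf.
have dp l := smooth_diff _ (smooth_partial l sf).
have cp l m (e : R) : 0 < e -> exists2 d : R, 0 < d & forall x,
    `|k - x| < d -> `|partial l (partial m f) k - partial l (partial m f) x| < e.
  move=> e0; have c : {for k, continuous (partial l (partial m f))}.
    apply: differentiable_continuous; apply: smooth_diff.
    by do 2 apply: smooth_partial.
  have /cvgrPdist_lt/(_ e e0)/nbhs_normP[d d0 dP] := c.
  by exists d.
apply/eqP; rewrite -subr_eq0 -normr_le0; apply/ler_addgt0Pl => e e0; rewrite addr0.
have e20 : 0 < e / 2 by rewrite divr_gt0.
have [d d0 dP] := cp i j _ e20; have [d' d'0 dP'] := cp j i _ e20.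
pose m := Num.min d d'; have m0 : 0 < m by rewrite lt_min d0.
(* The intermediate points lie within 2 h of k in the sup norm, and 2 h = m / 2 is below both
   radii. *)
pose h := m / 4; have h0 : 0 < h by rewrite divr_gt0.
have axis1 l : `|axis R l| <= 1.
  by rewrite prod_normE /= ge_max !normr_nat !lern1 !leq_b1.
have small (t s : R) a b : 0 <= t <= 1 -> 0 <= s <= 1 ->
    `|k - (k + (t * h) *: axis R a + (s * h) *: axis R b)| < m.
  move=> /andP[t0 t1] /andP[s0 s1].
  rewrite -addrA opprD addNKr normrN.
  apply: le_lt_trans (ler_normD _ _) _; rewrite normrZ [X in _ + X]normrZ.
  rewrite (@le_lt_trans _ _ (h + h)) //; last by rewrite /h; lra.
  have th r l : 0 <= r -> r <= 1 -> `|r * h| * `|axis R l| <= h.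
    move=> r0 r1; have hge0 := ltW h0.
    have rh0 : 0 <= r * h by exact: mulr_ge0.
    rewrite -[leRHS]mulr1; apply: ler_pM => //.
    by rewrite ger0_norm //; exact: ler_piMl.
  by apply: lerD; exact: th.
have [t [s [t01 s01 E]]] := @second_difference f i j k h df (dp^~ i).
have [t' [s' [t01' s01' E']]] := @second_difference f j i k h df (dp^~ j).
have eqP : partial j (partial i f) (k + (t * h) *: axis R i + (s * h) *: axis R j)
         = partial i (partial j f) (k + (t' * h) *: axis R j + (s' * h) *: axis R i).
  have hn0 : h != 0 by rewrite gt_eqF.
  have eqh (x y a b c z : R) : a - b - (c - z) = h * (h * x) ->
      a - c - (b - z) = h * (h * y) -> x = y.
    move=> ex ey; apply: (mulfI hn0); apply: (mulfI hn0).
    by rewrite -ex -ey; ring.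
  apply: eqh E _; rewrite [k + _ + _]addrAC; exact: E'.
have /dP : `|k - (k + (t' * h) *: axis R j + (s' * h) *: axis R i)| < d.
  by apply: lt_le_trans (small _ _ _ _ t01' s01') _; rewrite ge_min lexx.
have /dP' : `|k - (k + (t * h) *: axis R i + (s * h) *: axis R j)| < d'.
  by apply: lt_le_trans (small _ _ _ _ t01 s01) _; rewrite ge_min lexx orbT.
rewrite eqP => X Y; apply: ltW.
rewrite [e](splitr e) -[in ltLHS](subrKA (partial i (partial j f)
   (k + (t' * h) *: axis R j + (s' * h) *: axis R i))).
apply: le_lt_trans (ler_normD _ _) _.
by apply: ltrD; [exact: Y|rewrite distrC; exact: X].
Qed.

End MeanValue.

(** * Complex- and Hilbert-valued functions *)

Section ComplexFunctions.
Context {R : realType}.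
Implicit Types (a b : R * R -> R[i]) (z : R[i]) (i j : 'I_2) (k : R * R).

Lemma ReD (x y : R[i]) : complex.Re (x + y) = complex.Re x + complex.Re y.
Proof. by case: x y => [? ?] []. Qed.
Lemma ImD (x y : R[i]) : complex.Im (x + y) = complex.Im x + complex.Im y.
Proof. by case: x y => [? ?] []. Qed.
Lemma ReM (x y : R[i]) : complex.Re (x * y) =
  complex.Re x * complex.Re y + - (complex.Im x * complex.Im y).
Proof. by case: x y => [? ?] []. Qed.
Lemma ImM (x y : R[i]) : complex.Im (x * y) =
  complex.Re x * complex.Im y + complex.Im x * complex.Re y.
Proof. by case: x y => [? ?] []. Qed.
Lemma ReV (x : R[i]) : complex.Re x^-1 =
  complex.Re x * (complex.Re x * complex.Re x + complex.Im x * complex.Im x)^-1.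
Proof. by case: x. Qed.
Lemma ImV (x : R[i]) : complex.Im x^-1 =
  - (complex.Im x * (complex.Re x * complex.Re x + complex.Im x * complex.Im x)^-1).
Proof. by case: x. Qed.
Lemma Re_conj (x : R[i]) : complex.Re (conjc x) = complex.Re x.
Proof. by case: x. Qed.
Lemma Im_conj (x : R[i]) : complex.Im (conjc x) = - complex.Im x.
Proof. by case: x. Qed.
Lemma complex_eq (x y : R[i]) :
  complex.Re x = complex.Re y -> complex.Im x = complex.Im y -> x = y.
Proof. by case: x y => [? ?] [? ?] /= -> ->. Qed.

Lemma smoothD (V : normedModType R) (f g : R * R -> V) :
  smooth f -> smooth g -> smooth (fun k => f k + g k).
Proof. by move=> /smoothP sf /smoothP sg; apply/smoothP => n; apply: smooth_uptoD. Qed.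

Lemma smoothM (f g : R * R -> R) :
  smooth f -> smooth g -> smooth (fun k => f k * g k).
Proof. by move=> /smoothP sf /smoothP sg; apply/smoothP => n; apply: smooth_uptoM. Qed.

Lemma smoothN (f : R * R -> R) : smooth f -> smooth (fun k => - f k).
Proof. by move=> /smoothP sf; apply/smoothP => n; apply: smooth_uptoN. Qed.

Lemma smoothV (f : R * R -> R) : (forall k, f k != 0) ->
  smooth f -> smooth (fun k => (f k)^-1).
Proof. by move=> f0 /smoothP sf; apply/smoothP => n; apply: smooth_uptoV. Qed.

Lemma smooth_expR (f : R * R -> R) : smooth f -> smooth (fun k => expR (f k)).
Proof. by move=> /smoothP sf; apply/smoothP => n; apply: smooth_upto_expR. Qed.

Lemma smooth_cst (V : normedModType R) (x : V) : smooth (fun _ : R * R => x).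
Proof. by apply/smoothP => n; apply: smooth_upto_cst. Qed.

Lemma smooth_linear (V W : normedModType R) (L : {linear V -> W}) (f : R * R -> V) :
  continuous L -> smooth f -> smooth (fun k => L (f k)).
Proof. by move=> Lc /smoothP sf; apply/smoothP => n; apply: smooth_upto_linear. Qed.

Lemma csmooth_cst z : csmooth (fun _ : R * R => z).
Proof. by split; exact: smooth_cst. Qed.

Lemma csmoothD a b : csmooth a -> csmooth b -> csmooth (fun k => a k + b k).
Proof.
move=> [ra ia] [rb ib]; split.
  by under [X in smooth X]eq_fun do rewrite ReD; exact: smoothD.
by under [X in smooth X]eq_fun do rewrite ImD; exact: smoothD.
Qed.

Lemma csmoothM a b : csmooth a -> csmooth b -> csmooth (fun k => a k * b k).
Proof.
move=> [ra ia] [rb ib]; split.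
  under [X in smooth X]eq_fun do rewrite ReM.
  by apply: smoothD; [|apply: smoothN]; exact: smoothM.
by under [X in smooth X]eq_fun do rewrite ImM; apply: smoothD; exact: smoothM.
Qed.

Lemma csmoothV a : (forall k, a k != 0) -> csmooth a -> csmooth (fun k => (a k)^-1).
Proof.
move=> a0 [ra ia].
have n0 k : complex.Re (a k) * complex.Re (a k)
    + complex.Im (a k) * complex.Im (a k) != 0.
  apply: contra (a0 k); rewrite -!expr2 paddr_eq0 ?sqr_ge0 // !sqrf_eq0.
  by rewrite eq_complex.
have sn := smoothV n0 (smoothD (smoothM ra ra) (smoothM ia ia)).
split.
  by under [X in smooth X]eq_fun do rewrite ReV; exact: smoothM.
by under [X in smooth X]eq_fun do rewrite ImV; apply: smoothN; exact: smoothM.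
Qed.

Lemma csmooth_conj a : csmooth a -> csmooth (fun k => conjc (a k)).
Proof.
move=> [ra ia]; split.
  by under [X in smooth X]eq_fun do rewrite Re_conj.
by under [X in smooth X]eq_fun do rewrite Im_conj; exact: smoothN.
Qed.

Lemma csmooth_real (f : R * R -> R) : smooth f -> csmooth (fun k => (f k)%:C).
Proof. by split => //; exact: smooth_cst. Qed.

Lemma cpartial_cst i z k : cpartial i (fun=> z) k = 0.
Proof. by rewrite /cpartial /partial !derive_cst. Qed.

Lemma cpartialD i a b k : csmooth a -> csmooth b ->
  cpartial i (fun k => a k + b k) k = cpartial i a k + cpartial i b k.
Proof.
move=> [ra ia] [rb ib]; rewrite /cpartial.
under [X in partial i X k +i* _]eq_fun do rewrite ReD.
under [X in _ +i* partial i X k]eq_fun do rewrite ImD.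
by rewrite !partialD //; exact: smooth_diff.
Qed.

Lemma cpartialM i a b k : csmooth a -> csmooth b ->
  cpartial i (fun k => a k * b k) k = cpartial i a k * b k + a k * cpartial i b k.
Proof.
move=> [ra ia] [rb ib]; rewrite /cpartial.
under [X in partial i X k +i* _]eq_fun do rewrite ReM.
under [X in _ +i* partial i X k]eq_fun do rewrite ImM.
have dra := smooth_diff k ra; have dia := smooth_diff k ia.
have drb := smooth_diff k rb; have dib := smooth_diff k ib.
rewrite partialD ?partialN ?partialM //; do ?[exact: differentiableM |
  exact/differentiableN/differentiableM].
rewrite partialD ?partialM //; do ?exact: differentiableM.
by apply: complex_eq; rewrite !(ReD, ImD, ReM, ImM) /=; ring.
Qed.

Lemma cpartial_conj i a k : csmooth a ->
  cpartial i (fun k => conjc (a k)) k = conjc (cpartial i a k).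
Proof.
move=> [ra ia]; rewrite /cpartial.
under [X in partial i X k +i* _]eq_fun do rewrite Re_conj.
under [X in _ +i* partial i X k]eq_fun do rewrite Im_conj.
by rewrite partialN //; exact: smooth_diff.
Qed.

Lemma cpartial_expR i (r : R * R -> R) k : smooth r ->
  cpartial i (fun k => (expR (r k))%:C) k =
  (expR (r k))%:C * cpartial i (fun k => (r k)%:C) k.
Proof.
move=> sr; rewrite /cpartial /= partial_expR; last exact: smooth_diff.
by apply: complex_eq; rewrite ?ReM ?ImM /= /partial !derive_cst; ring.
Qed.

Lemma smooth_id : smooth (@id (R * R)).
Proof.
apply/smoothP; case=> [|n]; split => //;
  try by move=> k; exact: (@ex_diff _ _ _ _ _ _ _ (is_diff_id k)).
move=> i; apply: eq_smooth_upto (smooth_upto_cst n (axis R i)) => k.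
by rewrite /partial derive_id.
Qed.

Lemma smooth_fst : smooth (fun k => k.1 : R).
Proof. by apply: (smooth_linear (L := fst)) smooth_id => ?; exact: cvg_fst. Qed.

Lemma smooth_snd : smooth (fun k => k.2 : R).
Proof. by apply: (smooth_linear (L := snd)) smooth_id => ?; exact: cvg_snd. Qed.

Lemma cpartial_fst i k : cpartial i (fun k => (k.1)%:C) k = (i == 0)%:R.
Proof.
have did : differentiable (@id (R * R)) k by exact: ex_diff.
rewrite /cpartial /= (partial_linear (L := fst) _ _ did) => [|?]; last exact: cvg_fst.
by rewrite /partial derive_id derive_cst /=; case: (i == 0); exact: erefl.
Qed.

Lemma cpartial_snd i k : cpartial i (fun k => (k.2)%:C) k = (i == 1)%:R.
Proof.
have did : differentiable (@id (R * R)) k by exact: ex_diff.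
rewrite /cpartial /= (partial_linear (L := snd) _ _ did) => [|?]; last exact: cvg_snd.
by rewrite /partial derive_id derive_cst /=; case: (i == 1); exact: erefl.
Qed.

Lemma cpartial0_cst a p q : csmooth a ->
  (forall i k, cpartial i a k = 0) -> a p = a q.
Proof.
move=> [ra ia] a0; apply: complex_eq.
  apply: (partial0_cst (f := fun k => complex.Re (a k))) => [k|i k].
    exact: smooth_diff.
  exact: (congr1 (@complex.Re R) (a0 i k)).
apply: (partial0_cst (f := fun k => complex.Im (a k))) => [k|i k].
  exact: smooth_diff.
exact: (congr1 (@complex.Im R) (a0 i k)).
Qed.

End ComplexFunctions.

(** * Algebra of the complex inner product *)

Section HilbertAlgebra.
Context {R : realType} {H : hilbertType R}.
Implicit Types (x y z : H) (a b : R[i]).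

Lemma hdotDl x y z : hdot (x + y) z = hdot x z + hdot y z.
Proof. by rewrite hdot_conj hdotDr rmorphD /= -!hdot_conj. Qed.

Lemma hdotZl a x y : hdot (hscale a x) y = conjc a * hdot x y.
Proof. by rewrite hdot_conj hdotZr rmorphM /= -!hdot_conj. Qed.

Lemma hscale1 x : hscale 1 x = x.
Proof. by rewrite -[1]/(1%:C) hscale_real scale1r. Qed.

Lemma hscale0 x : hscale 0 x = 0.
Proof. by rewrite -[0]/(0%:C) hscale_real scale0r. Qed.

Lemma hscaler0 a : hscale a (0 : H) = 0.
Proof. by apply: (addrI (hscale a 0)); rewrite -hscaleDr !addr0. Qed.

Lemma hscaleN1 x : hscale (-1) x = - x.
Proof. by rewrite (_ : -1 = (-1)%:C) ?hscale_real ?scaleN1r ?rmorphN1. Qed.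

Lemma hdot0r x : hdot x 0 = 0.
Proof. by rewrite -(hscale0 0) hdotZr mul0r. Qed.

Lemma hdot0l x : hdot 0 x = 0.
Proof. by rewrite hdot_conj hdot0r conjc0. Qed.

Lemma hdotNr x y : hdot x (- y) = - hdot x y.
Proof. by rewrite -hscaleN1 hdotZr mulN1r. Qed.

Lemma hdot_eq0 x : (hdot x x == 0) = (x == 0).
Proof.
by rewrite hdot_norm -[0]/(0%:C) (inj_eq (@complexI _)) sqrf_eq0 normr_eq0.
Qed.

(** Linear identities between vectors are proved through it: pairing with an arbitrary [x] turns
    them into scalar identities for [ring] or [field]. *)
Lemma hdot_inj y z : (forall x, hdot x y = hdot x z) -> y = z.
Proof.
move=> e; apply/eqP; rewrite -subr_eq0 -hdot_eq0 hdotDr hdotNr.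
by rewrite -e subrr.
Qed.

Lemma hscale_dec a x : hscale a x =
  complex.Re a *: x + complex.Im a *: hscale 'i%C x.
Proof.
by rewrite -!hscale_real hscaleA -hscaleDl [in LHS](complexE a) [X in _ + X]mulrC.
Qed.

(** Reduces every statement about [hdot] to its real part, which is real bilinear and so open to the
    real calculus. *)
Lemma hdot_Im x y : complex.Im (hdot x y) = complex.Re (hdot (hscale 'i%C x) y).
Proof. by rewrite hdotZl; case: (hdot x y) => c d /=; ring. Qed.

Lemma norm_hscalei x : `|hscale 'i%C x| = `|x|.
Proof.
have : hdot (hscale 'i%C x) (hscale 'i%C x) = hdot x x.
  by rewrite hdotZl hdotZr mulrA; case: (hdot x x) => c d; simpc; congr Complex; ring.
rewrite !hdot_norm => /complexI /eqP.
by rewrite eqrXn2 // => /eqP.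
Qed.

(** Polarization gives continuity of the inner product from that of the norm, Cauchy-Schwarz from
    the triangle inequality, and preservation of inner products from preservation of norms. *)
Lemma rdot_polar x y :
  complex.Re (hdot x y) = (`|x + y| ^+ 2 - `|x| ^+ 2 - `|y| ^+ 2) / 2.
Proof.
apply: (canRL (mulfK _)); first by rewrite pnatr_eq0.
have eN (t : H) : `|t| ^+ 2 = complex.Re (hdot t t) by rewrite hdot_norm.
rewrite !eN hdotDl !hdotDr (hdot_conj y x) !ReD Re_conj; ring.
Qed.

End HilbertAlgebra.

Section HilbertCalculus.
Context {R : realType} {H : hilbertType R}.
Implicit Types (f g : R * R -> H) (a b : R * R -> R[i]) (i j : 'I_2) (k : R * R).

Fact hscalei_linear : linear (fun x : H => hscale ('i%C : R[i]) x).
Proof.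
move=> r x y; rewrite hscaleDr -!hscale_real !hscaleA; congr (hscale _ _ + _).
by rewrite mulrC.
Qed.

Definition hscalei (x : H) : H := hscale 'i%C x.
HB.instance Definition _ :=
  GRing.isLinear.Build R H H *:%R hscalei hscalei_linear.

Lemma hscalei_continuous : continuous hscalei.
Proof.
move=> x; apply/cvgrPdist_lt => e e0; near=> y.
rewrite -linearB /= /hscalei norm_hscalei; near: y.
exact: cvgr_dist_lt.
Unshelve. all: by end_near. Qed.

Definition rdot (x y : H) : R := complex.Re (hdot x y).

Lemma rdot_bilinear : bilinear_for (GRing.Scale.Law.clone _ _ *:%R _)
  (GRing.Scale.Law.clone _ _ *:%R _) rdot.
Proof.
split=> [x|x] c y z; rewrite /rdot /=.
  by rewrite hdotDl -hscale_real hdotZl ReD ReM /= oppr0 mul0r oppr0 addr0.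
by rewrite hdotDr -hscale_real hdotZr ReD ReM /= mul0r oppr0 addr0.
Qed.

Lemma rdot_continuous : continuous (fun p : H * H => rdot p.1 p.2).
Proof.
rewrite (_ : (fun _ => _) = fun p : H * H =>
    (`|p.1 + p.2| ^+ 2 - `|p.1| ^+ 2 - `|p.2| ^+ 2) / 2); last first.
  by apply/funext => p; exact: rdot_polar.
move=> p.
have cn (F : H * H -> H) : {for p, continuous F} ->
    {for p, continuous (fun q => `|F q| ^+ 2)}.
  move=> cF; apply: (@continuous_comp _ _ _ F (fun t : H => `|t| ^+ 2)) => //.
  apply: (@continuous_comp _ _ _ _ (fun t : R => t ^+ 2)).
    exact: norm_continuous.
  exact: exprn_continuous.
have c1 : {for p, continuous (fun q : H * H => q.1)} by exact: cvg_fst.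
have c2 : {for p, continuous (fun q : H * H => q.2)} by exact: cvg_snd.
apply: cvgM; last exact: cvg_cst.
apply: cvgB; last exact: cn c2.
apply: cvgB; last exact: cn c1.
apply: (cn (fun q : H * H => q.1 + q.2)); exact: continuousD.
Qed.

Lemma smooth_hscale a f : csmooth a -> smooth f ->
  smooth (fun k => hscale (a k) (f k)).
Proof.
move=> [/smoothP ra /smoothP ia] sf; under [X in smooth X]eq_fun do rewrite hscale_dec.
have /smoothP si := smooth_linear hscalei_continuous sf.
move: sf => /smoothP sf.
have sZ := smooth_upto_bilinear (@scale_bilinear R H) (@scale_cont2 R H).
by apply: smoothD; apply/smoothP => n; exact: sZ.
Qed.

Lemma partial_hscale i a f k : csmooth a -> smooth f ->
  partial i (fun k => hscale (a k) (f k)) k =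
  hscale (cpartial i a k) (f k) + hscale (a k) (partial i f k).
Proof.
move=> [ra ia] sf; under [X in partial _ X]eq_fun do rewrite hscale_dec.
have dra := smooth_diff k ra; have dia := smooth_diff k ia.
have df := smooth_diff k sf.
have dif : differentiable (fun k => hscale 'i%C (f k)) k.
  exact: (differentiable_linear hscalei_continuous).
have pif : partial i (fun k => hscale 'i%C (f k)) k = hscale 'i%C (partial i f k).
  exact: (partial_linear hscalei_continuous).
have dZ := differentiable_bilinear (@scale_bilinear R H) (@scale_cont2 R H).
have pZ := partial_bilinear (@scale_bilinear R H) (@scale_cont2 R H).
rewrite partialD; [|exact: dZ..].
rewrite !pZ // pif (hscale_dec (cpartial i a k)) (hscale_dec (a k)) /=.
by rewrite addrACA.
Qed.

Lemma partial_hscale_cst i (c : R[i]) f k : smooth f ->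
  partial i (fun k => hscale c (f k)) k = hscale c (partial i f k).
Proof.
move=> sf; have -> := partial_hscale i k (csmooth_cst c) sf.
by rewrite cpartial_cst; move: (partial i f k) => f'; rewrite hscale0 add0r.
Qed.

Lemma csmooth_hdot f g : smooth f -> smooth g -> csmooth (fun k => hdot (f k) (g k)).
Proof.
move=> sf sg; have /smoothP si := smooth_linear hscalei_continuous sf.
move: sf sg => /smoothP sf /smoothP sg.
have sB := smooth_upto_bilinear rdot_bilinear rdot_continuous.
split; first by apply/smoothP => n; exact: sB.
under [X in smooth X]eq_fun do rewrite hdot_Im.
by apply/smoothP => n; exact: sB.
Qed.

Lemma cpartial_hdot i f g k : smooth f -> smooth g ->
  cpartial i (fun k => hdot (f k) (g k)) k =
  hdot (partial i f k) (g k) + hdot (f k) (partial i g k).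
Proof.
move=> sf sg; have df := smooth_diff k sf; have dg := smooth_diff k sg.
have dif : differentiable (fun k => hscale 'i%C (f k)) k.
  exact: (differentiable_linear hscalei_continuous).
have pif : partial i (fun k => hscale 'i%C (f k)) k = hscale 'i%C (partial i f k).
  exact: (partial_linear hscalei_continuous).
have pB := partial_bilinear rdot_bilinear rdot_continuous.
rewrite /cpartial; under [X in _ +i* partial i X k]eq_fun do rewrite hdot_Im.
rewrite (pB i f g) // (pB i (fun k => hscale 'i%C (f k)) g) // pif /rdot -!hdot_Im.
by apply: complex_eq; rewrite ?ReD ?ImD.
Qed.

(** Pairing with a fixed vector commutes with [partial], so [schwarz_real] applies to the real
    pairings; [x] and [hscale 'i%C x] together recover the complex one. *)
Lemma schwarz f i j k : smooth f ->
  partial i (partial j f) k = partial j (partial i f) k.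
Proof.
move=> sf; pose r x k := rdot x (f k).
have sr x : smooth (r x).
  apply/smoothP => n; apply: (smooth_upto_bilinear rdot_bilinear rdot_continuous).
    exact: smooth_upto_cst.
  by move/smoothP: sf.
have pr x l (g : R * R -> H) : smooth g ->
    partial l (fun k => rdot x (g k)) = fun k => rdot x (partial l g k).
  move=> sg; apply/funext => q.
  rewrite (partial_bilinear rdot_bilinear rdot_continuous) //; last exact: smooth_diff.
  by rewrite /partial derive_cst /rdot hdot0l add0r.
have prr x l m : partial l (partial m (r x)) k = rdot x (partial l (partial m f) k).
  by rewrite /r pr // pr //; exact: smooth_partial.
have E x : rdot x (partial i (partial j f) k) = rdot x (partial j (partial i f) k).
  exact: etrans (esym (prr x i j)) (etrans (schwarz_real i j k (sr x)) (prr x j i)).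
apply: hdot_inj => x; apply: complex_eq; first exact: E.
exact: etrans (hdot_Im _ _) (etrans (E (hscale 'i%C x)) (esym (hdot_Im _ _))).
Qed.

Lemma partial_cst i (x : H) k : partial i (fun=> x) k = 0.
Proof. by rewrite /partial derive_cst. Qed.

End HilbertCalculus.

(** * Complex directional derivatives *)

(* Unification would otherwise unfold partial derivatives into limits. *)
Local Opaque partial cpartial.

Section ComplexDirections.
Context {R : realType}.
Implicit Types (a b : R * R -> R[i]) (w : R[i] * R[i]) (k : R * R).

Definition cder w a k : R[i] := w.1 * cpartial 0 a k + w.2 * cpartial 1 a k.

Definition cconj w : R[i] * R[i] := (conjc w.1, conjc w.2).

Lemma cconjK w : cconj (cconj w) = w.
Proof. by case: w => x y; rewrite /cconj /= !conjcK. Qed.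

Lemma cder_cst w (x : R[i]) k : cder w (fun=> x) k = 0.
Proof. by rewrite /cder !cpartial_cst !mulr0 addr0. Qed.

Lemma cderD w a b k : csmooth a -> csmooth b ->
  cder w (fun k => a k + b k) k = cder w a k + cder w b k.
Proof. by move=> sa sb; rewrite /cder !cpartialD // !mulrDr addrACA. Qed.

Lemma cderM w a b k : csmooth a -> csmooth b ->
  cder w (fun k => a k * b k) k = cder w a k * b k + a k * cder w b k.
Proof. move=> sa sb; rewrite /cder !cpartialM //.
by move: (cpartial 0 a k) (cpartial 1 a k) (cpartial 0 b k) (cpartial 1 b k) (a k)
  (b k) => *; ring. Qed.

Lemma cderZ w (x : R[i]) a k : csmooth a ->
  cder w (fun k => x * a k) k = x * cder w a k.
Proof. by move=> sa; rewrite cderM ?cder_cst ?mul0r ?add0r //; exact: csmooth_cst. Qed.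

Lemma cder_conj w a k : csmooth a ->
  cder w (fun k => conjc (a k)) k = conjc (cder (cconj w) a k).
Proof. by move=> sa; rewrite /cder !cpartial_conj // rmorphD !rmorphM /= !conjcK. Qed.

Lemma cderV w a k : csmooth a -> (forall k, a k != 0) ->
  cder w (fun k => (a k)^-1) k = - cder w a k / (a k) ^+ 2.
Proof.
move=> sa a0; have e : cder w (fun k => a k * (a k)^-1) k = 0.
  by under [X in cder _ X]eq_fun do rewrite mulfV //; exact: cder_cst.
move: e; rewrite cderM //; last exact: csmoothV.
move=> /eqP; rewrite addrC addr_eq0 => /eqP e; apply: (mulfI (a0 k)); rewrite e.
by field; exact: a0.
Qed.

Lemma cder_expR w (r : R * R -> R) k : smooth r ->
  cder w (fun k => (expR (r k))%:C) k =
  (expR (r k))%:C * cder w (fun k => (r k)%:C) k.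
Proof.
by move=> sr; rewrite /cder !cpartial_expR // mulrDr !mulrA ![w.1 * _]mulrC ![w.2 * _]mulrC.
Qed.

End ComplexDirections.

Section HilbertDirections.
Context {R : realType} {H : hilbertType R}.
Implicit Types (f g : R * R -> H) (a : R * R -> R[i]) (w : R[i] * R[i]) (k : R * R).

Definition hder w f k : H :=
  hscale w.1 (partial 0 f k) + hscale w.2 (partial 1 f k).

Lemma smooth_hder w f : smooth f -> smooth (hder w f).
Proof.
by move=> sf; apply: smoothD; apply: smooth_hscale (csmooth_cst _) _;
  exact: smooth_partial.
Qed.

Lemma hder_cst w (x : H) k : hder w (fun=> x) k = 0.
Proof. by rewrite /hder !partial_cst !hscaler0 addr0. Qed.

Lemma hderD w f g k : smooth f -> smooth g ->
  hder w (fun k => f k + g k) k = hder w f k + hder w g k.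
Proof.
move=> sf sg; have df := smooth_diff k sf; have dg := smooth_diff k sg.
by rewrite /hder !partialD // !hscaleDr addrACA.
Qed.

Lemma hder_hscale w a f k : csmooth a -> smooth f ->
  hder w (fun k => hscale (a k) (f k)) k =
  hscale (cder w a k) (f k) + hscale (a k) (hder w f k).
Proof.
move=> sa sf; rewrite /hder !partial_hscale //; apply: hdot_inj => x.
rewrite /cder.
move: (partial 0 f k) (partial 1 f k) (cpartial 0 a k) (cpartial 1 a k) => f0 f1 a0 a1.
by rewrite !(hdotDr, hdotZr); ring.
Qed.

Lemma cder_hdot w f g k : smooth f -> smooth g ->
  cder w (fun k => hdot (f k) (g k)) k =
  hdot (hder (cconj w) f k) (g k) + hdot (f k) (hder w g k).
Proof.
move=> sf sg; rewrite /cder !cpartial_hdot // /hder.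
move: (partial 0 f k) (partial 1 f k) (partial 0 g k) (partial 1 g k) => f0 f1 g0 g1.
by rewrite hdotDr hdotDl !hdotZr !hdotZl /= !conjcK; ring.
Qed.

Lemma hder_comm w1 w2 f k : smooth f ->
  hder w1 (hder w2 f) k = hder w2 (hder w1 f) k.
Proof.
move=> sf; have P w i :
    partial i (hder w f) k = hscale w.1 (partial i (partial 0 f) k)
                             + hscale w.2 (partial i (partial 1 f) k).
  have s (c : R[i]) j : smooth (fun k => hscale c (partial j f k)).
    by apply: smooth_hscale (csmooth_cst _) _; exact: smooth_partial.
  have sp j := smooth_partial j sf.
  apply: etrans (partialD i (smooth_diff k (s w.1 0)) (smooth_diff k (s w.2 1))) _.
  by congr (_ + _); exact: partial_hscale_cst.
rewrite [LHS]/hder [RHS]/hder !P; have := schwarz 1 0 k sf.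
move: (partial 0 (partial 0 f) k) (partial 1 (partial 1 f) k)
  (partial 1 (partial 0 f) k) (partial 0 (partial 1 f) k) => f00 f11 f10 f01 ->.
by apply: hdot_inj => x; rewrite !(hdotDr, hdotZr) /=; ring.
Qed.

End HilbertDirections.

Section ComplexCoordinate.
Context {R : realType} (tau : R[i]) (tau_im : tau - conjc tau != 0).
Implicit Types (a : R * R -> R[i]) (k : R * R).

(** The coefficients of d/dz: they solve w.1 + tau w.2 = 1 and w.1 + conj(tau) w.2 = 0. *)
Definition dz_dir : R[i] * R[i] := (- conjc tau / (tau - conjc tau), (tau - conjc tau)^-1).
Definition dzb_dir : R[i] * R[i] := cconj dz_dir.

Definition zcoord k : R[i] := (k.1)%:C + tau * (k.2)%:C.

Lemma dz_dirE : (dz_dir.1 = - conjc tau / (tau - conjc tau)) *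
  (dz_dir.2 = (tau - conjc tau)^-1).
Proof. by []. Qed.

Lemma dzb_dirE : (dzb_dir.1 = tau / (tau - conjc tau)) * (dzb_dir.2 = - (tau - conjc tau)^-1).
Proof.
have cD : conjc (tau - conjc tau) = - (tau - conjc tau).
  by rewrite rmorphB /= conjcK opprB.
rewrite /dzb_dir /cconj /= rmorphM /= !conjc_inv cD invrN rmorphN /= conjcK.
by rewrite mulrNN.
Qed.

Lemma cpartial0E a k : cpartial 0 a k = cder dz_dir a k + cder dzb_dir a k.
Proof. by rewrite /cder !dzb_dirE /=; field. Qed.

Lemma cpartial1E a k :
  cpartial 1 a k = tau * cder dz_dir a k + conjc tau * cder dzb_dir a k.
Proof. by rewrite /cder !dzb_dirE /=; field. Qed.

Lemma csmooth_zcoord : csmooth zcoord.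
Proof.
apply: csmoothD; first exact: (csmooth_real smooth_fst).
exact: csmoothM (csmooth_cst _) (csmooth_real smooth_snd).
Qed.

Let zcoordE i k : cpartial i zcoord k = (i == 0)%:R + tau * (i == 1)%:R.
Proof.
have s1 := csmooth_real (@smooth_fst R); have s2 := csmooth_real (@smooth_snd R).
have st := csmoothM (csmooth_cst tau) s2.
rewrite (cpartialD i k s1 st) (cpartialM i k (csmooth_cst tau) s2).
by rewrite cpartial_cst cpartial_fst cpartial_snd; ring.
Qed.

Lemma dz_zcoord k : cder dz_dir zcoord k = 1.
Proof. by rewrite /cder !zcoordE /=; field. Qed.

Lemma dzb_zcoord k : cder dzb_dir zcoord k = 0.
Proof. by rewrite /cder !zcoordE !dzb_dirE /=; field. Qed.

End ComplexCoordinate.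

(** * Iterated covariant derivatives *)

Section LandauTower.
Context {R : realType} {H : hilbertType R}.
Variables (w : R[i] * R[i]) (u : R * R -> H) (alpha beta : R * R -> R[i]) (c : R[i]).
Hypotheses (su : smooth u) (sa : csmooth alpha) (sb : csmooth beta).
Hypothesis hol : forall k, hder (cconj w) u k = hscale (beta k) (u k).
Hypothesis conn : forall k, hdot (u k) (hder w u k) = alpha k * hdot (u k) (u k).
Hypothesis curv : forall k, cder (cconj w) alpha k - cder w beta k = c.
Implicit Types (n m : nat) (k : R * R).

Let wb := cconj w.

Fixpoint tower n : R * R -> H :=
  if n is m.+1
  then fun k => hder w (tower m) k + hscale (- alpha k) (tower m k)
  else u.

Lemma smooth_tower n : smooth (tower n).
Proof.
elim: n => //= n IH; apply: smoothD; first exact: smooth_hder.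
apply: smooth_hscale => //.
rewrite (_ : (fun _ => _) = fun k => -1 * alpha k); last first.
  by apply/funext => k; rewrite mulN1r.
exact: csmoothM (csmooth_cst _) sa.
Qed.

Lemma hder_tower n k : hder w (tower n) k = tower n.+1 k + hscale (alpha k) (tower n k).
Proof.
rewrite /=; move: (hder w (tower n) k) (tower n k) => x y.
by rewrite -addrA -hscaleDl addNr hscale0 addr0.
Qed.

(** The lowering operator, the covariant derivative along [wb], annihilates [u], and moving it past
    each of the n raising operators costs one commutator -c. At n = 0 the truncated predecessor is
    harmless because its coefficient vanishes. *)
Lemma hderb_tower n k : hder wb (tower n) k =
  hscale (beta k) (tower n k) + hscale (- (n%:R * c)) (tower n.-1 k).
Proof.
elim: n k => [|n IH] k; first by rewrite /= hol mul0r oppr0 hscale0 addr0.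
have st := smooth_tower n; have st' := smooth_tower n.-1.
have sna : csmooth (fun k => - alpha k).
  rewrite (_ : (fun _ => _) = fun k => -1 * alpha k); last first.
    by apply/funext => q; rewrite mulN1r.
  exact: csmoothM (csmooth_cst _) sa.
have dna : cder wb (fun k => - alpha k) k = - cder wb alpha k.
  rewrite (_ : (fun _ => _) = fun k => -1 * alpha k); last first.
    by apply/funext => q; rewrite mulN1r.
  by rewrite (cderZ wb (-1) k sa) mulN1r.
(* Plain derivatives along [w] and [wb] commute; the commutator arises only from differentiating
   [alpha] here and [beta] below. *)
have -> : hder wb (tower n.+1) k = hder w (hder wb (tower n)) k
    + hscale (- cder wb alpha k) (tower n k)
    + hscale (- alpha k) (hder wb (tower n) k).
  rewrite [LHS](hderD wb k (smooth_hder w st) (smooth_hscale sna st)).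
  by rewrite (hder_hscale wb k sna st) dna hder_comm // addrA.
have -> : hder wb (tower n) = fun k => hscale (beta k) (tower n k)
    + hscale (- (n%:R * c)) (tower n.-1 k) by apply/funext.
rewrite (hderD w k (smooth_hscale sb st) (smooth_hscale (csmooth_cst _) st')).
rewrite (hder_hscale w k sb st) (hder_hscale w k (csmooth_cst _) st') cder_cst.
rewrite hder_tower hder_tower (_ : cder wb alpha k = c + cder w beta k); last first.
  by rewrite -(curv k) subrK.
case: n {IH st st' sna dna} => [|n].
  rewrite -[0.+1.-1]/0%N -[0.-1]/0%N.
  move: (tower 1 k) (tower 0 k) (cder w beta k) => x y b'.
  by apply: hdot_inj => v; rewrite !(hdotDr, hdotZr); ring.
rewrite -[n.+2.-1]/n.+1 -[n.+1.-1]/n.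
move: (tower n.+2 k) (tower n.+1 k) (tower n k) (cder w beta k) => x y z b'.
by apply: hdot_inj => v; rewrite !(hdotDr, hdotZr); ring.
Qed.

Let N k := hdot (u k) (u k).

Lemma cder_norm k : cder w N k = (conjc (beta k) + alpha k) * N k.
Proof. by rewrite /N cder_hdot // hol hdotZl conn; ring. Qed.

(** The left slot is conjugate-linear, so it receives the lowering operator while the right slot is
    raised. The remaining factor conj(beta) + alpha is the logarithmic derivative of [N], by
    [cder_norm]. *)
Lemma cder_hdot_tower n m k :
  cder w (fun k => hdot (tower n k) (tower m k)) k =
  (conjc (beta k) + alpha k) * hdot (tower n k) (tower m k)
  - n%:R * conjc c * hdot (tower n.-1 k) (tower m k) + hdot (tower n k) (tower m.+1 k).
Proof.
rewrite cder_hdot; [|exact: smooth_tower..].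
rewrite hderb_tower hder_tower.
move: (tower n k) (tower n.-1 k) (tower m k) (tower m.+1 k) => x y z t.
rewrite hdotDl hdotDr !hdotZl hdotZr rmorphN rmorphM /= rmorph_nat; ring.
Qed.

(** Differentiating the identity for m along [w] yields the one for m + 1, because lowering [u] on
    the left gives nothing. *)
Lemma hdot_tower0 m k : hdot (u k) (tower m.+1 k) = 0.
Proof.
elim: m k => [|m IH] k.
  rewrite /= hdotDr hdotZr conn; ring.
have e0 : cder w (fun k => hdot (tower 0 k) (tower m.+1 k)) k = 0.
  rewrite (_ : (fun _ => _) = fun=> 0) ?cder_cst //.
  exact/funext.
have := cder_hdot_tower 0 m.+1 k; rewrite e0 -[tower 0]/u IH.
by rewrite !mul0r mulr0 subr0 add0r => <-.
Qed.

(** By induction on m the ratio of <f_n, f_m> to [N] is constant, so differentiating along [w]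
    leaves <f_n, f_(m+1)> = n conj(c) <f_(n-1), f_m>. *)
Lemma hdot_tower n m k : hdot (tower n k) (tower m k) =
  (if n == m then n`!%:R * conjc c ^+ n else 0) * N k.
Proof.
elim: m n k => [|m IH] n k.
  case: n => [|n]; first by rewrite eqxx fact0 expr0 !mul1r.
  by rewrite hdot_conj hdot_tower0 conjc0 mul0r.
have := cder_hdot_tower n m k.
rewrite (_ : (fun _ => _) = fun k =>
  (if n == m then n`!%:R * conjc c ^+ n else 0) * N k); last exact/funext.
rewrite (cderZ w _ k (csmooth_hdot su su)) cder_norm.
rewrite !IH => /esym; set X := _ - _ => e; apply: (addrI X); rewrite e /X {X e}.
case: n => [|n]; first by rewrite /=; ring.
rewrite -[n.+1.-1]/n eqSS; case: (n == m); last by ring.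
by rewrite factS natrM exprS; ring.
Qed.

End LandauTower.

(** * Norm estimates *)

Section Norms.
Context {R : realType} {H : hilbertType R}.
Implicit Types (z : R[i]) (x y : H).
Local Notation normc := (@Normc.normc R).

Lemma normcP z : (normc z)%:C = `|z|.
Proof. by []. Qed.

Lemma normc_ge0 z : 0 <= normc z.
Proof. by rewrite -lecR normcP normr_ge0. Qed.

Lemma mulc_conj z : z * conjc z = (normc z ^+ 2)%:C.
Proof. by rewrite -sqr_normc -normcP rmorphXn. Qed.

Lemma normc_conj z : normc (conjc z) = normc z.
Proof. by case: z => a b; rewrite /= sqrrN. Qed.

Lemma normc_real (r : R) : normc r%:C = `|r|.
Proof. by rewrite /= expr0n /= addr0 sqrtr_sqr. Qed.

Lemma real_conjc z : conjc z = z -> z = (complex.Re z)%:C.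
Proof.
case: z => a b [/eqP]; rewrite eq_sym -subr_eq0 opprK -mulr2n mulrn_eq0 /=.
by move=> /eqP ->.
Qed.

Lemma norm_hscale (a : R[i]) x : `|hscale a x| = normc a * `|x|.
Proof.
have e : `|hscale a x| ^+ 2 = (normc a * `|x|) ^+ 2.
  apply: (@complexI R); rewrite -hdot_norm hdotZl hdotZr hdot_norm mulrA.
  by rewrite [conjc a * a]mulrC mulc_conj exprMn -rmorphM.
by apply/eqP; rewrite -(@eqrXn2 _ 2) ?mulr_ge0 ?normc_ge0 // e.
Qed.

Lemma cauchy_schwarz x y : normc (hdot x y) <= `|x| * `|y|.
Proof.
have rcs v : complex.Re (hdot x v) <= `|x| * `|v|.
  rewrite rdot_polar ler_pdivrMr //.
  have := lerXn2r 2 (normr_ge0 (x + v)) (addr_ge0 (normr_ge0 x) (normr_ge0 v))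
    (ler_normD x v).
  by rewrite sqrrD => ?; lra.
have [h0|h0] := eqVneq (normc (hdot x y)) 0; first by rewrite h0 mulr_ge0.
have hgt0 : 0 < normc (hdot x y) by rewrite lt_neqAle eq_sym h0 normc_ge0.
(* Multiplying y by conj <x, y> turns the inner product into its squared modulus, so the real bound
   applies; one factor of the modulus is then cancelled. *)
have := rcs (hscale (conjc (hdot x y)) y).
rewrite hdotZr [_ * hdot x y]mulrC mulc_conj /= norm_hscale normc_conj mulrCA expr2.
by rewrite ler_pM2l.
Qed.

Lemma expR_ge_term (X : R) n : 0 <= X -> X ^+ n / n`!%:R <= expR X.
Proof.
move=> X0; case: n => [|n].
  by rewrite fact0 expr0 divr1 -[leLHS]addr0 (le_trans _ (expR_ge1Dx X)) // lerD.
by apply: le_trans (expR_ge1Dxn n X0); rewrite lerDr.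
Qed.

(** The passage to the limit in the remainder estimate, from the archimedean property and n < 2 ^
    n. *)
Lemma half_pow_le0 (d M : R) : (forall n, d <= M / 2 ^+ n) -> d <= 0.
Proof.
move=> dM; rewrite leNgt; apply/negP => d0.
have M0 : 0 < M by have := dM 0%N; rewrite expr0 divr1; exact: lt_le_trans.
have [n] : exists n : nat, M / d < n%:R.
  by exists (Num.bound (M / d)); apply: archi_boundP; rewrite divr_ge0 // ltW.
rewrite ltr_pdivrMr // => ndM; have := dM n; rewrite ler_pdivlMr ?exprn_gt0 //.
apply/negP; rewrite -ltNge (lt_le_trans ndM) // mulrC ler_pM2l //.
by rewrite -natrX ler_nat ltnW // ltn_expl.
Qed.

End Norms.

Section Segment.
Context {R : realType} (tau : R[i]) (tau_im : tau - conjc tau != 0).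
Local Notation normc := (@Normc.normc R).
Local Notation w := (dz_dir tau).

(** For a real function the derivative along d/dzbar is the conjugate of the one along d/dz, so a
    bound on the latter controls both partials; this is the factor 2. *)
Lemma mean_value_cder (g : R * R -> R) (M : R) p q : smooth g ->
  (forall t : R, 0 <= t <= 1 ->
     normc (cder w (fun k => (g k)%:C) (p + t *: (q - p))) <= M) ->
  `|g q - g p| <= (`|(q - p).1| + `|(q - p).2| * normc tau) * (2 * M).
Proof.
move=> sg bd; have [t t01 ->] := mean_value_plane p q (fun k => smooth_diff k sg).
have := bd t t01; set k := p + _ => {}bd.
have sgc := csmooth_real sg.
have cb : cder (dzb_dir tau) (fun k => (g k)%:C) k
    = conjc (cder w (fun k => (g k)%:C) k).
  have := cder_conj (dzb_dir tau) k sgc; rewrite cconjK => <-.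
  by congr (cder _ _ _); apply/funext => l; rewrite conjc_real.
have gE i : partial i g k = complex.Re (cpartial i (fun k => (g k)%:C) k) by [].
have gN i : `|partial i g k| <= normc (cpartial i (fun k => (g k)%:C) k).
  by rewrite gE -lecR normcP normc_ge_Re.
have b0 : `|partial 0 g k| <= 2 * M.
  apply: le_trans (gN 0) _; rewrite (cpartial0E tau_im) cb.
  apply: le_trans (le_normcD _ _) _; rewrite normc_conj.
  by move: bd; move: (normc _) => ? ?; lra.
have b1 : `|partial 1 g k| <= normc tau * (2 * M).
  apply: le_trans (gN 1) _; rewrite (cpartial1E tau_im) cb.
  apply: le_trans (le_normcD _ _) _; rewrite !Normc.normcM !normc_conj -mulrDr.
  apply: ler_wpM2l; first exact: normc_ge0.
  by move: bd; move: (normc (cder _ _ _)) => ? ?; lra.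
apply: le_trans (ler_normD _ _) _; rewrite !normrM mulrDl; apply: lerD.
  exact: ler_wpM2l.
by rewrite -mulrA; exact: ler_wpM2l.
Qed.

End Segment.

(** * The overlap formula *)

Section Conj.
Context {R : rcfType}.
Implicit Types x y : R[i].

Lemma conjcD x y : conjc (x + y) = conjc x + conjc y.
Proof. exact: rmorphD. Qed.

Lemma conjcM x y : conjc (x * y) = conjc x * conjc y.
Proof. exact: rmorphM. Qed.

End Conj.

Section Transport.
Context {R : realType} {H : hilbertType R} (tau : R[i]).
Hypothesis tau_im : tau - conjc tau != 0.
Variables (u : R * R -> H) (alpha beta : R * R -> R[i]) (c : R).
Local Notation w := (dz_dir tau).
Local Notation wb := (dzb_dir tau).
Local Notation normc := (@Normc.normc R).
Hypotheses (su : smooth u) (sa : csmooth alpha) (sb : csmooth beta).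
Hypothesis u0 : forall k, u k != 0.
Hypothesis hol : forall k, hder wb u k = hscale (beta k) (u k).
Hypothesis conn : forall k, hdot (u k) (hder w u k) = alpha k * hdot (u k) (u k).
Hypothesis curv : forall k, cder wb alpha k - cder w beta k = c%:C.
Implicit Types (n m : nat) (k p q : R * R) (x : H).

Local Notation f := (tower w u alpha).
Let sf n := smooth_tower w su sa n.
Let N k := hdot (u k) (u k).

(** By [hdot_tower] at n = m = 1, c |u|^2 is the squared norm of the first tower vector. *)
Let curvature_ge0 : 0 <= c.
Proof.
have := hdot_tower su sa sb hol conn curv 1 1 0.
rewrite eqxx expr1 mul1r conjc_real !hdot_norm -rmorphM => /complexI e.
have : 0 <= c * `|u 0| ^+ 2 by rewrite -e sqr_ge0.
by rewrite pmulr_lge0 // exprn_gt0 // normr_gt0.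
Qed.

Let norm_tower n k : `|f n k| = Num.sqrt (n`!%:R * c ^+ n) * `|u k|.
Proof.
have := hdot_tower su sa sb hol conn curv n n k.
have -> : n`!%:R * conjc c%:C ^+ n = (n`!%:R * c ^+ n)%:C :> R[i].
  by rewrite conjc_real rmorphM rmorphXn /= rmorph_nat.
rewrite eqxx !hdot_norm -rmorphM => /complexI e.
have K0 : 0 <= n`!%:R * c ^+ n by rewrite mulr_ge0 // exprn_ge0.
apply/eqP; rewrite -(@eqrXn2 _ 2) ?mulr_ge0 ?sqrtr_ge0 //.
by rewrite e exprMn sqr_sqrtr.
Qed.

Section BasePoint.
Variable p : R * R.

Let y k : R[i] := zcoord tau k - zcoord tau p.

Let sy : csmooth y.
Proof. exact: csmoothD (csmooth_zcoord tau) (csmooth_cst _). Qed.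

Let dy k : cder w y k = 1.
Proof.
rewrite (cderD w k (csmooth_zcoord tau) (csmooth_cst _)) cder_cst addr0.
exact: dz_zcoord.
Qed.

Let dby k : cder wb y k = 0.
Proof.
rewrite (cderD wb k (csmooth_zcoord tau) (csmooth_cst _)) cder_cst addr0.
exact: dzb_zcoord.
Qed.

(** The coefficient (-y)^n / n!, in recursive form so that its derivatives follow by induction. *)
Fixpoint taylor_coef n : R * R -> R[i] :=
  if n is m.+1 then fun k => - m.+1%:R^-1 * (y k * taylor_coef m k) else fun=> 1.
Local Notation e := taylor_coef.

Let se n : csmooth (e n).
Proof.
elim: n => [|n IH]; first exact: csmooth_cst.
exact: csmoothM (csmooth_cst _) (csmoothM sy IH).
Qed.

Let de n k : cder w (e n.+1) k = - e n k.
Proof.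
elim: n k => [|n IH] k.
  rewrite (cderZ w _ k (csmoothM sy (se 0))) (cderM w k sy (se 0)) dy /=.
  by rewrite cder_cst invr1; ring.
rewrite (cderZ w _ k (csmoothM sy (se n.+1))) (cderM w k sy (se n.+1)) dy IH.
have n0 : n.+1%:R != 0 :> R[i] by rewrite pnatr_eq0.
have n1 : n.+2%:R != 0 :> R[i] by rewrite pnatr_eq0.
rewrite -[e n.+1 k]/(- n.+1%:R^-1 * (y k * e n k)).
move: n1; rewrite -[n.+2%:R]natr1.
by move: (n.+1%:R) n0 (y k) (e n k) => r r0 a b r1; field; rewrite r0 r1.
Qed.

Let dbe n k : cder wb (e n) k = 0.
Proof.
elim: n k => [|n IH] k; first exact: cder_cst.
rewrite (cderZ wb _ k (csmoothM sy (se n))) (cderM wb k sy (se n)) dby IH.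
by rewrite mul0r mulr0 addr0 mulr0.
Qed.

(** The Taylor expansion is taken about the moving point k and evaluated at p; at k = p only the
    zeroth term is left, which is u_p. The index counts terms, so index 0 is the empty sum. *)
Fixpoint transport n : R * R -> H :=
  if n is m.+1 then fun k => transport m k + hscale (e m k) (f m k) else fun=> 0.
Local Notation S := transport.

Let sef n : smooth (fun k => hscale (e n k) (f n k)).
Proof. exact: smooth_hscale. Qed.

Let sS n : smooth (S n).
Proof. by elim: n => [|n IH]; [exact: smooth_cst|exact: smoothD]. Qed.

Let hderS v n k : hder v (S n.+1) k = hder v (S n) k
  + (hscale (cder v (e n) k) (f n k) + hscale (e n k) (hder v (f n) k)).
Proof.
apply: etrans (hderD v k (sS n) (sef n)) _; congr (_ + _).
exact: hder_hscale.
Qed.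

(** The sum telescopes: differentiating each coefficient cancels the raised vector of the term
    before it, so only the last raised vector survives as the truncation error. *)
Let dS n k : hder w (S n.+1) k =
  hscale (alpha k) (S n.+1 k) + hscale (e n k) (f n.+1 k).
Proof.
elim: n k => [|n IH] k; rewrite hderS.
  rewrite hder_cst cder_cst hder_tower.
  rewrite -[S 1 k]/(0 + hscale 1 (f 0 k)) -[e 0 k]/1.
  move: (f 1 k) (f 0 k) => f1 f0.
  by apply: hdot_inj => x; rewrite !(hdotDr, hdotZr, hdot0r); ring.
rewrite IH de hder_tower.
rewrite -[S n.+2 k]/(S n.+1 k + hscale (e n.+1 k) (f n.+1 k)).
move: (S n.+1 k) (f n.+2 k) (f n.+1 k) (e n.+1 k) => s f2 f1 e1.
by apply: hdot_inj => x; rewrite !(hdotDr, hdotZr); ring.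
Qed.

(** Lowering turns e_m f_m into c y e_(m-1) f_(m-1), so the sum reproduces itself with one term
    fewer, multiplied by c y. *)
Let dbS n k : hder wb (S n.+1) k =
  hscale (beta k) (S n.+1 k) + hscale (c%:C * y k) (S n k).
Proof.
elim: n k => [|n IH] k; rewrite hderS.
  rewrite hder_cst cder_cst.
  rewrite (hderb_tower su sa sb hol curv 0).
  rewrite -[S 1 k]/(0 + hscale 1 (f 0 k)) -[e 0 k]/1 -[S 0 k]/0 -[f 0.-1 k]/(f 0 k).
  move: (f 0 k) => f0.
  by apply: hdot_inj => x; rewrite !(hdotDr, hdotZr, hdot0r); ring.
rewrite IH dbe.
rewrite (hderb_tower su sa sb hol curv n.+1) -[f n.+1.-1 k]/(f n k).
rewrite -[S n.+2 k]/(S n.+1 k + hscale (e n.+1 k) (f n.+1 k)).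
rewrite -[S n.+1 k]/(S n k + hscale (e n k) (f n k)).
rewrite -[e n.+1 k]/(- n.+1%:R^-1 * (y k * e n k)).
have n0 : n.+1%:R != 0 :> R[i] by rewrite pnatr_eq0.
move: n.+1%:R n0 (S n k) (f n.+1 k) (f n k) (e n k) => r r0 s f1 f0 e0.
by apply: hdot_inj => x; rewrite !(hdotDr, hdotZr); field; rewrite r0.
Qed.

Let ysq k : R := complex.Re (y k * conjc (y k)).

Let ysqE k : ysq k = normc (y k) ^+ 2.
Proof. by rewrite /ysq mulc_conj. Qed.

Let gauss k : R := expR (- c * ysq k).

Let sgauss : smooth gauss.
Proof.
apply: smooth_expR; apply: smoothM; first exact: smooth_cst.
by case: (csmoothM sy (csmooth_conj sy)).
Qed.

Let dgauss k : cder w (fun k => (gauss k)%:C) k = - c%:C * conjc (y k) * (gauss k)%:C.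
Proof.
have sq : csmooth (fun k => y k * conjc (y k)) := csmoothM sy (csmooth_conj sy).
rewrite (cder_expR w k (smoothM (smooth_cst (- c)) (proj1 sq))).
rewrite (_ : (fun _ => _) = fun k => (- c)%:C * (y k * conjc (y k))); last first.
  apply/funext => l; rewrite rmorphM /=; congr (_ * _).
  by rewrite [RHS]real_conjc // rmorphM /= conjcK mulrC.
rewrite (cderZ w _ k sq) (cderM w k sy (csmooth_conj sy)) dy (cder_conj w k sy).
rewrite -[cconj w]/wb dby conjc0 rmorphN /= /gauss /ysq.
by rewrite mul1r mulr0 addr0 mulrC.
Qed.

Section Vector.
Variable x : H.

Let s n k := hdot x (S n k).
Let ss n : csmooth (s n).
Proof. exact: csmooth_hdot (smooth_cst x) (sS n). Qed.

Let ds n k : cder w (s n.+1) k = alpha k * s n.+1 k + e n k * hdot x (f n.+1 k).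
Proof.
rewrite (cder_hdot w k (smooth_cst x) (sS n.+1)) hder_cst hdot0l add0r dS.
by rewrite hdotDr !hdotZr.
Qed.

Let dbs n k : cder wb (s n.+1) k = beta k * s n.+1 k + c%:C * y k * s n k.
Proof.
rewrite (cder_hdot wb k (smooth_cst x) (sS n.+1)) hder_cst hdot0l add0r dbS.
by rewrite hdotDr !hdotZr.
Qed.

Let N0 k : N k != 0.
Proof. by rewrite /N hdot_eq0. Qed.

(** Division by |u|^2 removes the gauge terms and [gauss] the factor c y of [dbS], so this function
    of k is constant up to truncation. *)
Let overlap n k : R := complex.Re (s n k * conjc (s n k)) / `|u k| ^+ 2 * gauss k.

Let overlapE n : (fun k => (overlap n k)%:C) =
  fun k => s n k * conjc (s n k) * (N k)^-1 * (gauss k)%:C.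
Proof. by apply/funext => k; rewrite /overlap /N hdot_norm mulc_conj -fmorphV -!rmorphM. Qed.

Let soverlap n : smooth (overlap n).
Proof.
have [+ _] : csmooth (fun k => (overlap n k)%:C).
  rewrite overlapE.
  exact: csmoothM (csmoothM (csmoothM (ss n) (csmooth_conj (ss n)))
    (csmoothV N0 (csmooth_hdot su su))) (csmooth_real sgauss).
exact.
Qed.

(** Both remaining terms contain the last coefficient [e n]: the first comes from the error in [dS],
    the second from the difference of two consecutive sums in [dbS]. *)
Let doverlap n k : cder w (fun k => (overlap n.+1 k)%:C) k =
  (e n k * hdot x (f n.+1 k) * conjc (s n.+1 k)
   - c%:C * conjc (y k) * s n.+1 k * conjc (e n k * hdot x (f n k)))
  * (N k)^-1 * (gauss k)%:C.
Proof.
rewrite overlapE.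
have sN := csmooth_hdot su su; have sg := csmooth_real sgauss.
have sV := csmoothV N0 sN; have sc := csmooth_conj (ss n.+1).
have ssc := csmoothM (ss n.+1) sc.
rewrite (cderM w k (csmoothM ssc sV) sg) (cderM w k ssc sV) (cderM w k (ss n.+1) sc).
rewrite dgauss (cderV w k sN N0) (cder_norm su hol conn) (cder_conj w k (ss n.+1)).
rewrite -[cconj w]/wb dbs ds.
have -> : s n.+1 k = s n k + e n k * hdot x (f n k) by rewrite /s /= hdotDr hdotZr.
have := N0 k; rewrite -[hdot (u k) (u k)]/(N k).
move: (s n k) (e n k) (hdot x (f n k)) (hdot x (f n.+1 k)) (N k) (gauss k)%:C
  (y k) (alpha k) (beta k) => s0 e0 h0 h1 N1 g y0 a b N10.
rewrite !(conjcD, conjcM) conjc_real; move: (conjc b) => b'.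
by field.
Qed.

Section Bounds.
Variables (rho : R) (k : R * R).
Hypothesis yk : normc (y k) <= rho.
(** The square root of exp(16 c rho^2), which makes coefficient times tower norm at most K / 4^n.
    The ratio 1/4 absorbs the growth 2^n (1 + c) allowed for the next tower norm and still leaves 1
    / 2^n. *)
Let K : R := expR (8 * (c * rho ^+ 2)).

Let rho0 : 0 <= rho.
Proof. exact: le_trans (normc_ge0 _) yk. Qed.

Let normc_coef n : normc (e n k) = normc (y k) ^+ n / n`!%:R.
Proof.
elim: n => [|n IH]; first by rewrite /e Normc.normc1 fact0 expr0 divr1.
rewrite /= Normc.normcM Normc.normcM IH normcN Normc.normcV.
have -> : normc (n.+1%:R) = n.+1%:R.
  by rewrite -(rmorph_nat (real_complex R)) normc_real normr_nat.
by rewrite factS natrM exprS invfM; ring.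
Qed.

Let coef_bound n : normc (e n k) * Num.sqrt (n`!%:R * c ^+ n) <= K / 4 ^+ n.
Proof.
have K0 : 0 <= K by exact: expR_ge0.
have f0 : 0 < n`!%:R :> R by rewrite ltr0n fact_gt0.
have fc0 : 0 <= n`!%:R * c ^+ n by rewrite mulr_ge0 ?ler0n // exprn_ge0.
rewrite -(@ler_pXn2r _ 2) // ?nnegrE; last 2 first.
- by rewrite mulr_ge0 ?sqrtr_ge0 ?normc_ge0.
- by rewrite divr_ge0 // exprn_ge0.
have -> : (normc (e n k) * Num.sqrt (n`!%:R * c ^+ n)) ^+ 2
    = (c * normc (y k) ^+ 2) ^+ n / n`!%:R.
  rewrite normc_coef exprMn sqr_sqrtr // exprMn -!exprM mulnC exprMn -exprM.
  by move: n`!%:R f0 => r r0; field; rewrite gt_eqF //.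
have X0 : 0 <= c * rho ^+ 2 by rewrite mulr_ge0 // sqr_ge0.
apply: (@le_trans _ _ ((c * rho ^+ 2) ^+ n / n`!%:R)).
  rewrite ler_pM2r ?invr_gt0 //; apply: lerXn2r; rewrite ?nnegrE //.
    by rewrite mulr_ge0 // sqr_ge0.
  by apply: ler_wpM2l => //; apply: lerXn2r; rewrite ?nnegrE ?normc_ge0.
(* With X = c rho^2, the square of the left-hand side is at most X^n / n!,
   and (16 X)^n / n! <= exp(16 X). *)
have := @expR_ge_term R (16 * (c * rho ^+ 2)) n (mulr_ge0 (ler0n _ 16) X0).
rewrite exprMn -mulrA -ler_pdivlMl ?exprn_gt0 // => /le_trans; apply.
rewrite exprMn /K -expRM_natl -exprVn -exprVn -exprM mulnC exprM mulrC.
rewrite (_ : 2%:R * (8 * (c * rho ^+ 2)) = 16 * (c * rho ^+ 2)); last by ring.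
by rewrite (_ : 4^-1 ^+ 2 = 16^-1 :> R) //; field.
Qed.

Let transport_bound n : `|S n k| <= `|u k| * (2 * K).
Proof.
have K0 : 0 <= K by exact: expR_ge0.
have p4 m : 0 < 4 ^+ m :> R by exact: exprn_gt0.
(* A strengthening for the induction: 2 - 2 / 4^n vanishes at n = 0 and increases by at least 1 /
   4^n at each step. *)
suff b : `|S n k| <= `|u k| * (K * (2 - 2 / 4 ^+ n)).
  apply: le_trans b _; apply: ler_wpM2l => //; rewrite mulrC ler_wpM2r //.
  by rewrite gerBl divr_ge0 // ltW.
elim: n => [|n IH]; first by rewrite normr0 expr0 divr1 subrr !mulr0.
apply: le_trans (ler_normD _ _) _; apply: le_trans (lerD IH (lexx _)) _.
rewrite norm_hscale norm_tower mulrA [_ * `|u k|]mulrC -mulrDr ler_wpM2l //.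
apply: le_trans (lerD (lexx _) (coef_bound n)) _.
rewrite -mulrDr ler_wpM2l // exprS.
have : 0 < (4 ^+ n)^-1 :> R by rewrite invr_gt0.
rewrite invfM; move: (_^-1) => t t0; lra.
Qed.

(** Cauchy-Schwarz bounds each pairing, the Gaussian is at most 1, and all powers of |u k| cancel;
    the bound depends on k only through [rho] and so holds along a whole segment. *)
Lemma norm_doverlap n : normc (cder w (fun k => (overlap n.+1 k)%:C) k)
  <= 2 * K ^+ 2 * `|x| ^+ 2 * (1 + c + c * rho) / 2 ^+ n.
Proof.
have K0 : 0 <= K by exact: expR_ge0.
have nu0 : 0 < `|u k| by rewrite normr_gt0.
have g1 : gauss k <= 1.
  by rewrite /gauss -expR0 ler_expR mulNr oppr_le0 ysqE mulr_ge0 // sqr_ge0.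
have p2 : 0 < 2 ^+ n :> R by exact: exprn_gt0.
have A := coef_bound n; set a := normc (e n k) in A *.
have a0 : 0 <= a by exact: normc_ge0.
set q := Num.sqrt _ in A.
have q0 : 0 <= q by exact: sqrtr_ge0.
have nf : `|f n k| = q * `|u k| by rewrite norm_tower.
have nf1 : `|f n.+1 k| <= q * (2 ^+ n * (1 + c)) * `|u k|.
  rewrite norm_tower ler_wpM2r //.
  have -> : n.+1`!%:R * c ^+ n.+1 = (n`!%:R * c ^+ n) * (n.+1%:R * c).
    by rewrite factS natrM exprS; ring.
  rewrite sqrtrM ?mulr_ge0 ?exprn_ge0 // -/q ler_wpM2l //.
  have n2 : n.+1%:R <= 2 ^+ n :> R by rewrite -natrX ler_nat ltn_expl.
  have n1 : 1 <= 2 ^+ n :> R by rewrite exprn_ege1 // ler1n.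
  apply: (@le_trans _ _ (1 + n.+1%:R * c)).
    have t0 : 0 <= n.+1%:R * c by rewrite mulr_ge0.
    rewrite -(@ler_pXn2r _ 2) // ?nnegrE ?sqrtr_ge0 ?addr_ge0 // sqr_sqrtr //.
    by move: (_ * c) t0 => t t0; nra.
  by rewrite mulrDr mulr1 lerD // ler_wpM2r.
have sN : normc (s n.+1 k) <= `|x| * (`|u k| * (2 * K)).
  by apply: le_trans (cauchy_schwarz _ _) _; rewrite ler_wpM2l.
have h1 : normc (hdot x (f n.+1 k)) <= `|x| * (q * (2 ^+ n * (1 + c)) * `|u k|).
  by apply: le_trans (cauchy_schwarz _ _) _; rewrite ler_wpM2l.
have h0 : normc (hdot x (f n k)) <= `|x| * (q * `|u k|).
  by apply: le_trans (cauchy_schwarz _ _) _; rewrite nf.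
have aq : a * q <= K / (2 ^+ n * 2 ^+ n).
  by rewrite -exprMn (_ : 2 * 2 = 4 :> R) //; ring.
have ah1 : a * normc (hdot x (f n.+1 k)) <= `|x| * `|u k| * (K * (1 + c)) / 2 ^+ n.
  apply: le_trans (ler_wpM2l a0 h1) _.
  rewrite (_ : a * _ = a * q * (`|x| * (2 ^+ n * (1 + c)) * `|u k|)); last by ring.
  apply: le_trans (ler_wpM2r _ aq) _.
    by rewrite !mulr_ge0 ?addr_ge0 // ltW.
  rewrite le_eqVlt; apply/orP; left; apply/eqP; move: (2 ^+ n) p2 => r r0; field; rewrite gt_eqF //.
have ah0 : a * normc (hdot x (f n k)) <= `|x| * `|u k| * K / 2 ^+ n.
  apply: le_trans (ler_wpM2l a0 h0) _.
  rewrite (_ : a * _ = a * q * (`|x| * `|u k|)); last by ring.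
  have n1 : 1 <= 2 ^+ n :> R by rewrite exprn_ege1 // ler1n.
  apply: le_trans (ler_wpM2r _ aq) _; first by rewrite mulr_ge0.
  rewrite mulrC -mulrA ler_wpM2l ?mulr_ge0 // ler_wpM2l //.
  by rewrite lef_pV2 ?posrE ?mulr_gt0 // ler_peMl // ltW.
rewrite doverlap !Normc.normcM Normc.normcV /N hdot_norm !normc_real.
rewrite (ger0_norm (expR_ge0 _)) (ger0_norm (sqr_ge0 _)).
have bnd : normc (e n k * hdot x (f n.+1 k) * conjc (s n.+1 k)
    - c%:C * conjc (y k) * s n.+1 k * conjc (e n k * hdot x (f n k)))
    <= (`|x| * `|u k| * (K * (1 + c)) / 2 ^+ n) * (`|x| * (`|u k| * (2 * K)))
     + c * rho * (`|x| * (`|u k| * (2 * K))) * (`|x| * `|u k| * K / 2 ^+ n).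
  apply: le_trans (le_normcD _ _) _; rewrite normcN !Normc.normcM !normc_conj.
  rewrite Normc.normcM normc_real (ger0_norm curvature_ge0) -/a.
  apply: lerD; first by rewrite ler_pM ?mulr_ge0 ?normc_ge0.
  rewrite ler_pM ?mulr_ge0 ?normc_ge0 // ler_pM ?mulr_ge0 ?normc_ge0 //.
  by rewrite ler_wpM2l.
apply: le_trans (ler_wpM2l _ g1) _.
  by rewrite mulr_ge0 ?normc_ge0 ?invr_ge0 ?sqr_ge0.
rewrite mulr1; apply: le_trans (ler_wpM2r _ bnd) _; first by rewrite invr_ge0 sqr_ge0.
rewrite le_eqVlt; apply/orP; left; apply/eqP; move: (2 ^+ n) p2 (`|u k|) nu0 => r r0 v v0.
by field; rewrite !gt_eqF.
Qed.

End Bounds.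

(** The values of [overlap n.+1] at p and q do not depend on n, and they differ by a constant over
    2^n at most. On the segment |y| is largest at q, which gives [rho]. *)
Lemma overlap_eq q h : (forall n, s n.+1 q = h) ->
  normc h ^+ 2 / `|u q| ^+ 2 * gauss q = normc (hdot x (u p)) ^+ 2 / `|u p| ^+ 2.
Proof.
move=> sq; have ep n : e n.+1 p = 0 by rewrite /= /y subrr mul0r mulr0.
have Sp n : S n.+1 p = u p.
  elim: n => [|n IH]; first by rewrite /= hscale1 add0r.
  by rewrite -[S n.+2 p]/(S n.+1 p + hscale (e n.+1 p) (f n.+1 p)) IH ep hscale0 addr0.
have oq n : overlap n.+1 q = normc h ^+ 2 / `|u q| ^+ 2 * gauss q.
  by rewrite /overlap sq mulc_conj.
have op n : overlap n.+1 p = normc (hdot x (u p)) ^+ 2 / `|u p| ^+ 2.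
  rewrite /overlap {1 2}/s Sp mulc_conj /gauss /ysq /y subrr mul0r /= mulr0.
  by rewrite expR0 mulr1.
pose rho := normc (y q).
have yt (t : R) : 0 <= t <= 1 -> normc (y (p + t *: (q - p))) <= rho.
  move=> /andP[t0 t1].
  have -> : y (p + t *: (q - p)) = t%:C * y q.
    rewrite /y /zcoord -[(p + t *: (q - p)).1]/(p.1 + t * (q.1 - p.1)).
    rewrite -[(p + t *: (q - p)).2]/(p.2 + t * (q.2 - p.2)).
    by rewrite !rmorphD !rmorphM /= !rmorphB /=; ring.
  by rewrite Normc.normcM normc_real ger0_norm // ler_piMl // normc_ge0.
apply/eqP; rewrite -subr_eq0 -normr_le0; apply: half_pow_le0 => n.
have := mean_value_cder tau_im (soverlap n.+1)
  (fun t t01 => norm_doverlap (yt t t01) n).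
rewrite oq op !mulrA; exact.
Qed.

End Vector.

Lemma overlap_gauss q :
  normc (hdot (u q) (u p)) ^+ 2 = `|u q| ^+ 2 * `|u p| ^+ 2 * gauss q.
Proof.
(* The choice x = u_q freezes the value at q: all tower vectors beyond the zeroth are orthogonal to
   u_q there. *)
have S1 n : hdot (u q) (S n.+1 q) = hdot (u q) (u q).
  elim: n => [|n IH]; first by rewrite /= hscale1 add0r.
  rewrite -[S n.+2 q]/(S n.+1 q + hscale (e n.+1 q) (f n.+1 q)) hdotDr IH hdotZr.
  by rewrite (hdot_tower0 su sa sb hol conn curv) mulr0 addr0.
have := overlap_eq S1; rewrite hdot_norm normc_real ger0_norm ?sqr_ge0 //.
have a0 k : `|u k| != 0 by rewrite normr_eq0.
move=> /esym /(canRL (divfK _)) -> //; last by rewrite expf_eq0 /= a0.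
by move: (`|u p|) (`|u q|) (a0 q) (gauss q) => a b b0 g; field.
Qed.

End BasePoint.

Lemma overlap_gaussian p q : normc (hdot (u p) (u q)) ^+ 2 =
  `|u p| ^+ 2 * `|u q| ^+ 2
  * expR (- c * normc (zcoord tau p - zcoord tau q) ^+ 2).
Proof. by rewrite overlap_gauss mulc_conj. Qed.

End Transport.

(** * Flat Kaehler bands *)

Section BandGeometry.
Context {R : realType} {H : hilbertType R} (u : R * R -> H).
Hypotheses (su : smooth u) (u0 : forall k, u k != 0).
Implicit Types (i j : 'I_2) (k : R * R).
Local Notation A := (berry_connection u).
Local Notation F := (berry_curvature u).
Local Notation g := (quantum_metric u).

Let N k := hdot (u k) (u k).
Let N0 k : N k != 0. Proof. by rewrite /N hdot_eq0. Qed.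
Let sN : csmooth N. Proof. exact: csmooth_hdot. Qed.

(** The quantum geometric tensor: the Gram matrix of the components of the derivatives orthogonal to
    [u], divided by <u, u>. *)
Definition geometric_tensor i j k : R[i] :=
  hdot (partial i u k) (partial j u k) / hdot (u k) (u k)
  - hdot (partial i u k) (u k) * hdot (u k) (partial j u k) / hdot (u k) (u k) ^+ 2.
Local Notation Q := geometric_tensor.

Lemma csmooth_connection i : csmooth (A i).
Proof.
exact: csmoothM (csmooth_hdot su (smooth_partial i su)) (csmoothV N0 sN).
Qed.

Let cpartial_connection i j k : cpartial i (A j) k =
  (hdot (partial i u k) (partial j u k) + hdot (u k) (partial i (partial j u) k)) / N k
  - hdot (u k) (partial j u k)
    * (hdot (partial i u k) (u k) + hdot (u k) (partial i u k)) / N k ^+ 2.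
Proof.
have sh := csmooth_hdot su (smooth_partial j su).
have cV : cpartial i (fun k => (N k)^-1) k = - cpartial i N k / N k ^+ 2.
  pose w : R[i] * R[i] := ((i == 0)%:R, (i == 1)%:R).
  have E a : cpartial i a k = cder w a k.
    rewrite /cder /w; case: i {sh w} => [[|[|]]] // ? /=;
    by rewrite mul1r mul0r ?addr0 ?add0r; congr (cpartial _ _ _); apply: val_inj.
  by rewrite !E cderV.
rewrite [LHS](cpartialM i k sh (csmoothV N0 sN)) cV.
rewrite (cpartial_hdot i k su su) (cpartial_hdot i k su (smooth_partial j su)).
by rewrite -/(N k); ring.
Qed.

Lemma curvatureE i j k : F k i j = Q i j k - Q j i k.
Proof.
rewrite mxE !cpartial_connection (schwarz i j k su) /Q -/(N k).
move: (hdot (u k) (partial j (partial i u) k)) => t.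
move: (hdot (partial i u k) (partial j u k)) (hdot (partial j u k) (partial i u k)).
move: (hdot (u k) (partial i u k)) (hdot (u k) (partial j u k)).
move: (hdot (partial i u k) (u k)) (hdot (partial j u k) (u k)) => *; ring.
Qed.

Lemma geometric_tensorC i j k : Q j i k = conjc (Q i j k).
Proof.
rewrite /Q -/(N k) rmorphB /= !rmorphM /= !conjc_inv rmorphXn /=.
have -> : conjc (N k) = N k by rewrite /N -hdot_conj.
by rewrite -!hdot_conj; ring.
Qed.

Lemma geometric_tensorE i j k : Q i j k = (g k i j)%:C + F k i j / 2.
Proof.
rewrite curvatureE (geometric_tensorC i j).
have -> : g k i j = complex.Re (Q i j k) by rewrite mxE.
by rewrite ReJ_add; move: (Q i j k) => z; move: (conjc z) => z'; field.
Qed.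

(** * The Kähler identity in the complex coordinate of J *)

Section Kahler.
Context (J : 'M[R]_2) (J2 : J *m J = - 1%:M).
Hypotheses (kahler : kahler_wrt u J) (flat : geometrically_flat u).

Let J00 : J 0 0 ^+ 2 + J 0 1 * J 1 0 = -1.
Proof.
have := congr1 (fun M : 'M[R]_2 => M 0 0) J2; rewrite !mxE big_ord_recl big_ord1.
by rewrite (_ : lift _ _ = 1) ?expr2 //; apply: val_inj.
Qed.

Let J10 : J 1 0 * J 0 0 + J 1 1 * J 1 0 = 0.
Proof.
have := congr1 (fun M : 'M[R]_2 => M 1 0) J2; rewrite !mxE big_ord_recl big_ord1.
by rewrite (_ : lift _ _ = 1) ?oppr0 //; apply: val_inj.
Qed.

Let J10_neq0 : J 1 0 != 0.
Proof.
apply/eqP => J0; move: J00; rewrite J0 mulr0 addr0 => e.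
by have := sqr_ge0 (J 0 0); rewrite e ler0N1.
Qed.

Let J11 : J 1 1 = - J 0 0.
Proof.
apply/eqP; rewrite -addr_eq0 -(mulrI_eq0 _ (mulfI J10_neq0)) -J10; apply/eqP; ring.
Qed.

(* The holomorphic coordinate of the complex structure J is k_1 + modulus * k_2. *)
Definition modulus : R[i] := (- J 0 0 / J 1 0) +i* (J 1 0)^-1.
Local Notation tau := modulus.

Lemma modulus_neq_conj : tau - conjc tau != 0.
Proof.
rewrite /tau eq_complex /= negb_and opprK -mulr2n mulrn_eq0 invr_eq0.
by rewrite J10_neq0 orbT.
Qed.

Let F0i k i : F k i i = 0.
Proof. by rewrite mxE subrr. Qed.

Let F10 k : F k 1 0 = - F k 0 1.
Proof. by rewrite !mxE opprB. Qed.

Let kahlerE k i j : (g k i j)%:C = - ('i%C / 2) * (F k i 0 * (J 0 j)%:C + F k i 1 * (J 1 j)%:C).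
Proof.
have := congr1 (fun M : 'M[R[i]]_2 => M i j) (kahler k).
rewrite [in LHS]mxE => ->; rewrite [LHS]mxE [in LHS]mxE big_ord_recl big_ord1.
rewrite (_ : lift _ _ = 1); last exact: val_inj.
by rewrite ![map_mx _ _ _ _]mxE.
Qed.

Let i2 : ('i%C : R[i]) ^+ 2 + 1 = 0. Proof. by rewrite sqr_i addNr. Qed.

(** Once 'i is generalized, [field] treats it as a free variable; [t] is the explicit quotient of
    the difference by i^2 + 1. *)
Let by_i2 (x y t : R[i]) : x - y = t * ('i%C ^+ 2 + 1) -> x = y.
Proof. by rewrite i2 mulr0 => /eqP; rewrite subr_eq0 => /eqP. Qed.

Let tauE : tau * (J 1 0)%:C = 'i%C - (J 0 0)%:C.
Proof. by apply: complex_eq; rewrite !(ReM, ImM) /=; field. Qed.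

Let ctauE : conjc tau * (J 1 0)%:C = - 'i%C - (J 0 0)%:C.
Proof. by apply: complex_eq; rewrite !(ReM, ImM) /=; field. Qed.

Let Q00 k : Q 0 0 k = (g k 0 0)%:C.
Proof. by rewrite geometric_tensorE F0i mul0r addr0. Qed.

Let Q00E k : Q 0 0 k = - ('i%C / 2) * (F k 0 1 * (J 1 0)%:C).
Proof. by rewrite Q00 kahlerE F0i mul0r add0r. Qed.

Let J11c : (J 1 1)%:C = - (J 0 0)%:C :> R[i].
Proof. by rewrite J11 rmorphN. Qed.

(** The Kähler identity gives the tensor rank at most one: with t_0 = 1 and t_1 = tau, Q_ij =
    conj(t_i) t_j Q_00. This and the next two facts are its entries. *)
Let Q01 k : Q 0 1 k = tau * Q 0 0 k.
Proof.
rewrite geometric_tensorE kahlerE F0i J11c Q00E mul0r add0r.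
rewrite (_ : tau * _ = - ('i%C / 2) * (F k 0 1 * (tau * (J 1 0)%:C))); last by ring.
rewrite tauE; move: (F k 0 1) ('i%C) (J 0 0)%:C (by_i2) => z i a H0.
by apply: (H0 _ _ (z / 2)); field.
Qed.

Let Q10 k : Q 1 0 k = conjc tau * Q 0 0 k.
Proof. by rewrite geometric_tensorC Q01 conjcM -geometric_tensorC. Qed.

Let Q11 k : Q 1 1 k = conjc tau * tau * Q 0 0 k.
Proof.
have Jn : (J 1 0)%:C != 0 :> R[i] by rewrite fmorph_eq0.
apply: (mulIf Jn); rewrite geometric_tensorE kahlerE F0i F10 Q00E mul0r addr0 mul0r addr0.
rewrite (_ : conjc tau * _ * _ * _ = - ('i%C / 2) * (F k 0 1
  * ((tau * (J 1 0)%:C) * (conjc tau * (J 1 0)%:C)))); last by ring.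
rewrite tauE ctauE.
have : (J 0 1)%:C * (J 1 0)%:C = - 1 - (J 0 0)%:C ^+ 2 :> R[i].
  have := congr1 (real_complex R) J00.
  by rewrite rmorphD rmorphXn rmorphM rmorphN1 /= => <-; ring.
rewrite (_ : - ('i%C / 2) * _ * (J 1 0)%:C =
  'i%C / 2 * F k 0 1 * ((J 0 1)%:C * (J 1 0)%:C)); last by ring.
move=> ->; move: (F k 0 1) ('i%C) (J 0 0)%:C (by_i2) => z i a H0.
by apply: (H0 _ _ (- i / 2 * z)); field.
Qed.

Local Notation w := (dz_dir tau).
Local Notation wb := (dzb_dir tau).
Definition holomorphic_connection k := w.1 * A 0 k + w.2 * A 1 k.
Definition antiholomorphic_connection k := wb.1 * A 0 k + wb.2 * A 1 k.
Local Notation alpha := holomorphic_connection.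
Local Notation beta := antiholomorphic_connection.

Lemma csmooth_holomorphic_connection : csmooth alpha.
Proof.
by apply: csmoothD; apply: csmoothM (csmooth_cst _) _; exact: csmooth_connection.
Qed.

Lemma csmooth_antiholomorphic_connection : csmooth beta.
Proof.
by apply: csmoothD; apply: csmoothM (csmooth_cst _) _; exact: csmooth_connection.
Qed.

(** The squared norm of the covariant derivative along [wb] is the geometric tensor evaluated on
    [wb], times <u, u>. By the rank-one form it contains wb.1 + tau wb.2 = dz/dzbar = 0, whose
    conjugate is [wz]. *)
Lemma hder_antiholomorphic k : hder wb u k = hscale (beta k) (u k).
Proof.
apply/eqP; rewrite -subr_eq0 -hdot_eq0.
pose v i := partial i u k + hscale (- A i k) (u k).
have vv i j : hdot (v i) (v j) = Q i j k * N k.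
  have Ac : conjc (A i k) = hdot (partial i u k) (u k) / N k.
    rewrite /berry_connection conjcM conjc_inv -!hdot_conj //.
  rewrite /v hdotDl !hdotDr !hdotZr !hdotZl rmorphN /= Ac.
  have := N0 k; rewrite /berry_connection /Q -/(N k).
  move: (N k) (hdot (partial i u k) (partial j u k)) (hdot (partial i u k) (u k))
    (hdot (u k) (partial j u k)) => n a b d n0.
  by field.
have -> : hder wb u k - hscale (beta k) (u k) = hscale wb.1 (v 0) + hscale wb.2 (v 1).
  rewrite /hder /beta /v; move: (partial 0 u k) (partial 1 u k) (A 0 k) (A 1 k) => a b d e.
  by rewrite -hscaleN1; apply: hdot_inj => x; rewrite !(hdotDr, hdotZr); ring.
have wz : w.1 + conjc tau * w.2 = 0.
  by rewrite /=; field; exact: modulus_neq_conj.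
clearbody v; rewrite hdotDl !hdotDr !hdotZr !hdotZl !vv Q01 Q10 Q11 !conjcK.
apply/eqP; move: (conjc tau) wz => t wz.
transitivity ((w.1 + t * w.2) * (wb.1 + tau * wb.2) * (Q 0 0 k * N k)); first by ring.
by rewrite wz !mul0r.
Qed.

Lemma hdot_hder_holomorphic k : hdot (u k) (hder w u k) = alpha k * hdot (u k) (u k).
Proof.
rewrite /hder hdotDr !hdotZr /alpha /berry_connection -/(N k); have := N0 k.
move: (N k) (hdot _ _) (hdot _ _) => n a b n0; by field.
Qed.

Let curvE k : F k 0 1 = (tau - conjc tau) * (g k 0 0)%:C.
Proof.
rewrite -Q00 Q00E.
rewrite (_ : _ * (- _ * _) = - ('i%C / 2) * (F k 0 1
  * (tau * (J 1 0)%:C - conjc tau * (J 1 0)%:C))); last by ring.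
rewrite tauE ctauE; move: (F k 0 1) ('i%C) (J 0 0)%:C (by_i2) => z i a H0.
by apply: (H0 _ _ z); field.
Qed.

Lemma curvature_cst k k' : F k 0 1 = F k' 0 1.
Proof. by rewrite !curvE (flat k k'). Qed.

(** The left side is [F k 0 1] times the determinant wb.1 w.2 - wb.2 w.1 = 1 / (tau - conj tau). In
    [g 0 0 0] the first 0 is a point of the plane. *)
Lemma connection_commutator k : cder wb alpha k - cder w beta k = (g 0 0 0)%:C.
Proof.
have sA i := csmooth_connection i.
have sZ (x : R[i]) i := csmoothM (csmooth_cst x) (sA i).
have D v x y : cder v (fun k => x * A 0 k + y * A 1 k) k =
    x * cder v (A 0) k + y * cder v (A 1) k.
  by rewrite (cderD v k (sZ x 0) (sZ y 1)) !cderZ.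
rewrite !D -(flat k 0).
have := curvE k; rewrite mxE /cder !dzb_dirE !dz_dirE => e.
have D0 := modulus_neq_conj; apply: (mulfI D0); rewrite -e.
move: (cpartial 0 (A 0) k) (cpartial 1 (A 0) k) (cpartial 0 (A 1) k)
  (cpartial 1 (A 1) k) => a00 a10 a01 a11.
by move: (conjc tau) D0 => t D0; field.
Qed.

Lemma unit_square_measure :
  (lebesgue_measure \x lebesgue_measure)%E (`[0, 1] `*` `[0, 1] : set (R * R)) = 1%E.
Proof.
rewrite product_measure1E //= !lebesgue_measure_itv /= lte_fin ltr01.
by rewrite -EFinB subr0 mule1.
Qed.

(** The curvature is constant and the unit square has measure one, so the Chern integral is the
    curvature itself; thus J and the Chern number determine the Gaussian's width. *)
Lemma metric_chern k : (tau - conjc tau) * (g k 0 0)%:C = 2 * pi%:C * 'i%C * chern_number u.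
Proof.
rewrite -curvE /chern_number.
have -> : cintegral (`[0, 1] `*` `[0, 1]) (fun k => F k 0 1) = F k 0 1.
  rewrite /cintegral.
  have I (r : R) : Rintegral (lebesgue_measure \x lebesgue_measure)%E
      (`[0, 1] `*` `[0, 1]) (fun _ : R * R => r) = r.
    have mS : measurable (`[0, 1] `*` `[0, 1] : set (R * R)).
      exact: (measurableX (measurable_itv _) (measurable_itv _)).
    rewrite Rintegral_cst //; transitivity (r * fine (1%E : \bar R)).
      by congr (_ * fine _); exact: unit_square_measure.
    by rewrite mulr1.
  rewrite (_ : (fun k => complex.Re (F k 0 1)) = fun=> complex.Re (F k 0 1)); last first.
    by apply/funext => l; rewrite (curvature_cst l k).
  rewrite (_ : (fun k => complex.Im (F k 0 1)) = fun=> complex.Im (F k 0 1)); last first.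
    by apply/funext => l; rewrite (curvature_cst l k).
  by rewrite !I; case: (F k 0 1).
rewrite mulrA mulfV ?mul1r // !mulf_neq0 //.
- by rewrite fmorph_eq0 gt_eqF // pi_gt0.
- by rewrite eq_complex /= oner_eq0 andbF.
Qed.

Lemma flat_kahler_overlap p q :
  Normc.normc (hdot (u p) (u q)) ^+ 2 = `|u p| ^+ 2 * `|u q| ^+ 2
  * expR (- g 0 0 0 * Normc.normc (zcoord tau p - zcoord tau q) ^+ 2).
Proof.
exact: (overlap_gaussian modulus_neq_conj su csmooth_holomorphic_connection
  csmooth_antiholomorphic_connection u0 hder_antiholomorphic hdot_hder_holomorphic
  connection_commutator).
Qed.

End Kahler.

End BandGeometry.

(** * Rigidity *)

Section Rigidity.
Context {R : realType}.
Implicit Types (p q k : R * R).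
Local Notation normc := (@Normc.normc R).

Section Coordinate.
Context (tau : R[i]) (tau_im : tau - conjc tau != 0).
Local Notation w := (dz_dir tau).
Local Notation wb := (dzb_dir tau).

(** Differentiating a conj(a) along [wb] leaves a times the conjugate of the derivative of a along
    [w]; since a never vanishes, both derivatives are zero. *)
Lemma holomorphic_cst_modulus (a : R * R -> R[i]) (K : R[i]) p q :
  csmooth a -> (forall k, a k != 0) -> (forall k, cder wb a k = 0) ->
  (forall k, a k * conjc (a k) = K) -> a p = a q.
Proof.
move=> sa a0 da aK; have dw k : cder w a k = 0.
  have e : cder wb (fun k => a k * conjc (a k)) k = 0.
    rewrite (_ : (fun _ => _) = fun=> K) ?cder_cst //.
    exact/funext.
  move: e; rewrite (cderM wb k sa (csmooth_conj sa)) da mul0r add0r (cder_conj wb k sa).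
  by rewrite cconjK => /eqP; rewrite mulf_eq0 (negPf (a0 k)) conjc_eq0 => /eqP.
apply: cpartial0_cst => // i k.
have -> : i = 0 \/ i = 1 -> cpartial i a k = 0.
- by case=> ->; rewrite ?(cpartial0E tau_im) ?(cpartial1E tau_im) dw da ?mulr0 addr0.
- by [].
by case: i => [[|[|]]] //= ?; [left|right]; exact: val_inj.
Qed.

Section TwoMaps.
Context {H H' : hilbertType R} (u : R * R -> H) (u' : R * R -> H').
Variables (beta beta' : R * R -> R[i]) (E : R * R -> R * R -> R).
Hypotheses (su : smooth u) (su' : smooth u').
Hypotheses (u0 : forall k, u k != 0) (u0' : forall k, u' k != 0).
Hypothesis hol : forall k, hder wb u k = hscale (beta k) (u k).
Hypothesis hol' : forall k, hder wb u' k = hscale (beta' k) (u' k).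
Hypothesis E0 : forall p q, 0 < E p q.
Hypothesis overlap : forall p q,
  normc (hdot (u p) (u q)) ^+ 2 = `|u p| ^+ 2 * `|u q| ^+ 2 * E p q.
Hypothesis overlap' : forall p q,
  normc (hdot (u' p) (u' q)) ^+ 2 = `|u' p| ^+ 2 * `|u' q| ^+ 2 * E p q.

Let a p q := hdot (u p) (u q).
Let b p q := hdot (u' p) (u' q).

Let n0 k : `|u k| != 0. Proof. by rewrite normr_eq0. Qed.
Let n0' k : `|u' k| != 0. Proof. by rewrite normr_eq0. Qed.

Let a0 p q : a p q != 0.
Proof.
apply/eqP => e; have : 0 < `|u p| ^+ 2 * `|u q| ^+ 2 * E p q.
  by apply: mulr_gt0 => //; apply: mulr_gt0; rewrite exprn_gt0 // normr_gt0.
by rewrite -overlap -/(a p q) e Normc.normc0 expr0n ltxx.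
Qed.

Let b0 p q : b p q != 0.
Proof.
apply/eqP => e; have : 0 < `|u' p| ^+ 2 * `|u' q| ^+ 2 * E p q.
  by apply: mulr_gt0 => //; apply: mulr_gt0; rewrite exprn_gt0 // normr_gt0.
by rewrite -overlap' -/(b p q) e Normc.normc0 expr0n ltxx.
Qed.

Let sa p : csmooth (a p). Proof. exact: csmooth_hdot (smooth_cst _) su. Qed.
Let sb p : csmooth (b p). Proof. exact: csmooth_hdot (smooth_cst _) su'. Qed.

Let da p k : cder wb (a p) k = beta k * a p k.
Proof.
by rewrite (cder_hdot wb k (smooth_cst (u p)) su) hder_cst hdot0l add0r hol hdotZr.
Qed.

Let db p k : cder wb (b p) k = beta' k * b p k.
Proof.
by rewrite (cder_hdot wb k (smooth_cst (u' p)) su') hder_cst hdot0l add0r hol' hdotZr.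
Qed.

(* In this combination of overlaps all gauge factors of u_q and u'_q cancel. *)
Let cross p q := b p q * a 0 q / (a p q * b 0 q).

Let cross_cst p q : cross p q = cross p 0.
Proof.
have sP := csmoothM (sb p) (sa 0); have sQ := csmoothM (sa p) (sb 0).
have Q0 k : a p k * b 0 k != 0 by rewrite mulf_neq0.
(* The value of K is read off from the overlap formulas: the factors [E p k] and [E 0 k] cancel
   between the two bands, and so do |u_k| and |u'_k|. *)
apply: (holomorphic_cst_modulus (K := (`|u' p| ^+ 2 * `|u 0| ^+ 2
    / (`|u p| ^+ 2 * `|u' 0| ^+ 2))%:C)) => [|k|k|k].
- exact: csmoothM sP (csmoothV Q0 sQ).
- by rewrite !mulf_neq0 // invr_eq0.
- rewrite (cderM wb k sP (csmoothV Q0 sQ)) (cderV wb k sQ Q0).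
  rewrite (cderM wb k (sb p) (sa 0)) (cderM wb k (sa p) (sb 0)) !da !db.
  move: (a p k) (a0 p k) (b p k) (a 0 k) (b 0 k) (b0 0 k) => x x0 y z t t0.
  by field; rewrite x0 t0.
- rewrite mulc_conj; congr _%:C; rewrite /cross !(Normc.normcM, Normc.normcV).
  rewrite !(exprMn, exprVn) overlap overlap' overlap overlap'.
  have [ep e0] := (E0 p k, E0 0 k).
  move: (`|u p|) (n0 p) (`|u k|) (n0 k) (`|u 0|) (`|u' p|) (`|u' k|) (n0' k)
    (`|u' 0|) (n0' 0) (E p k) ep (E 0 k) e0 => r1 h1 r2 h2 r3 r4 r5 h5 r6 h6 x hx y hy.
  by field; rewrite h1 h2 h5 h6 !gt_eqF.
Qed.

(** Pairing with the vectors at 0 determines lambda up to a phase; the prefactor chooses lambda(0) =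
    |u'_0| / |u_0| > 0. *)
Definition gauge q : R[i] := (`|u 0| / `|u' 0|)%:C * (hdot (u' 0) (u' q) / hdot (u 0) (u q)).

Lemma csmooth_gauge : csmooth gauge.
Proof.
exact: csmoothM (csmooth_cst _) (csmoothM (sb 0) (csmoothV (a0 0) (sa 0))).
Qed.

Lemma gauge_neq0 q : gauge q != 0.
Proof.
rewrite /gauge mulf_neq0 ?fmorph_eq0 //; first by rewrite mulf_neq0 ?invr_eq0.
by rewrite mulf_neq0 ?invr_eq0 //; [exact: b0|exact: a0].
Qed.

Lemma gram_gauge p q : hdot (u' p) (u' q) =
  conjc (gauge p) * gauge q * hdot (u p) (u q).
Proof.
have := cross_cst p q; rewrite /cross.
have e0 : a 0 0 = (`|u 0| ^+ 2)%:C by exact: hdot_norm.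
have e0' : b 0 0 = (`|u' 0| ^+ 2)%:C by exact: hdot_norm.
have cg : conjc (gauge p) = (`|u 0| / `|u' 0|)%:C * (b p 0 / a p 0).
  by rewrite /gauge !conjcM conjc_real conjc_inv -!hdot_conj.
rewrite cg /gauge e0 e0' -/(a p q) -/(b p q) -/(a 0 q) -/(b 0 q).
rewrite !rmorphXn !rmorphM !fmorphV /=.
have r0 : (`|u' 0|)%:C != 0 :> R[i] by rewrite fmorph_eq0.
move: (a p q) (a0 p q) (a 0 q) (a0 0 q) (a p 0) (a0 p 0) (b p q) (b 0 q) (b0 0 q)
  (b p 0) (`|u 0|)%:C (`|u' 0|)%:C r0 => x1 h1 x2 h2 x3 h3 y1 y2 k2 y3 z z' hz e.
have -> : y1 = (y1 * x2 / (x1 * y2)) * (x1 * y2 / x2) by field; rewrite h1 h2 k2.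
by rewrite e; field; rewrite h2 h3 hz.
Qed.

End TwoMaps.
End Coordinate.
End Rigidity.

(** * Isometry between families with equal Gram kernels *)

Section GramIsometry.
Context {R : realType} {T : Type}.

Section Graph.
Context {H H' : hilbertType R} (u : T -> H) (v : T -> H').

(** A relation rather than a function, because a vector may have several expansions;
    single-valuedness comes later from norm preservation. The inverse is the same relation with [u]
    and [v] exchanged. *)
Inductive span_graph : H -> H' -> Prop :=
| span_graph0 : span_graph 0 0
| span_graphS a t x y :
    span_graph x y -> span_graph (hscale a (u t) + x) (hscale a (v t) + y).

Lemma span_graphD x y x' y' :
  span_graph x y -> span_graph x' y' -> span_graph (x + x') (y + y').
Proof.
elim=> [|a t x1 y1 _ IH] g'; first by rewrite !add0r.
by rewrite -!addrA; apply: span_graphS; exact: IH.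
Qed.

Lemma span_graphZ c x y : span_graph x y -> span_graph (hscale c x) (hscale c y).
Proof.
elim=> [|a t x1 y1 _ IH]; first by rewrite !hscaler0; exact: span_graph0.
by rewrite !hscaleDr !hscaleA; exact: span_graphS.
Qed.

Lemma span_graph_fst x y : span_graph x y -> complex_span (range u) x.
Proof.
elim=> [|a t x1 y1 _ [n [c [f [fu ->]]]]].
  by exists 0, (fun=> 0), (fun=> 0); split; [case|rewrite big_ord0].
exists n.+1, (fun i => oapp c a (unlift ord0 i)), (fun i => oapp f (u t) (unlift ord0 i)).
split; first by move=> i; case: unliftP => [j|] _ /=; [exact: fu|exists t].
rewrite big_ord_recl unlift_none /=; congr (_ + _).
by apply: eq_bigr => i _; rewrite liftK.
Qed.

Lemma span_graph_exists x : complex_span (range u) x -> exists y, span_graph x y.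
Proof.
move=> [n [c [f [fu ->]]]]; elim: n c f fu => [|n IH] c f fu.
  by rewrite big_ord0; exists 0; exact: span_graph0.
have [y gy] := IH (fun i => c (lift ord0 i)) (fun i => f (lift ord0 i)) (fun i => fu _).
have [t _ ft] := fu ord0.
by rewrite big_ord_recl -ft; exists (hscale (c ord0) (v t) + y); exact: span_graphS.
Qed.

(** The closure of [span_graph] in the product, that is, the graph of the extension by
    continuity. *)
Definition closed_graph (x : H) (y : H') : Prop := forall e : R, 0 < e ->
  exists x' y', [/\ span_graph x' y', `|x - x'| < e & `|y - y'| < e].

Lemma closed_graph_fst x y : closed_graph x y -> closed_span (range u) x.
Proof.
move=> g B /nbhs_normP[e e0 eB]; have [x' [y' [gx xx' _]]] := g e e0.
by exists x'; split; [exact: span_graph_fst gx|exact: eB].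
Qed.

Lemma span_closed_graph x y : span_graph x y -> closed_graph x y.
Proof. by move=> g e e0; exists x, y; rewrite !subrr !normr0. Qed.

Lemma closed_graphD x y x' y' :
  closed_graph x y -> closed_graph x' y' -> closed_graph (x + x') (y + y').
Proof.
move=> g g' e e0; have e2 : 0 < e / 2 by rewrite divr_gt0.
have [x1 [y1 [G1 X1 Y1]]] := g _ e2; have [x2 [y2 [G2 X2 Y2]]] := g' _ e2.
exists (x1 + x2), (y1 + y2); split; first exact: span_graphD.
  rewrite opprD addrACA [e](splitr e).
  by apply: le_lt_trans (ler_normD _ _) _; exact: ltrD.
rewrite opprD addrACA [e](splitr e).
by apply: le_lt_trans (ler_normD _ _) _; exact: ltrD.
Qed.

Lemma closed_graphZ c x y : closed_graph x y -> closed_graph (hscale c x) (hscale c y).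
Proof.
move=> g e e0; have n0 := normc_ge0 c.
have d0 : 0 < e / (Normc.normc c + 1) by rewrite divr_gt0 // ltr_wpDl.
have [x1 [y1 [G1 X1 Y1]]] := g _ d0.
have bnd (K : hilbertType R) (z z1 : K) : `|z - z1| < e / (Normc.normc c + 1) ->
    `|hscale c z - hscale c z1| < e.
  rewrite ltr_pdivlMr ?ltr_wpDl // => zz.
  rewrite -hscaleN1 hscaleA mulrC -hscaleA -hscaleDr hscaleN1 norm_hscale.
  apply: le_lt_trans zz; rewrite mulrC ler_wpM2l // lerDl //.
exists (hscale c x1), (hscale c y1); split; [exact: span_graphZ|exact: bnd..].
Qed.

Hypothesis gram : forall s t, hdot (v s) (v t) = hdot (u s) (u t).

Lemma span_graph_hdot x y x' y' :
  span_graph x y -> span_graph x' y' -> hdot y y' = hdot x x'.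
Proof.
move=> g g'; elim: g => [|a t x1 y1 _ IH]; first by rewrite !hdot0l.
rewrite !hdotDl !hdotZl IH; congr (_ * _ + _).
elim: g' => [|b s x2 y2 _ IH']; first by rewrite !hdot0r.
by rewrite !hdotDr !hdotZr IH' gram.
Qed.

Lemma span_graph_norm x y : span_graph x y -> `|y| = `|x|.
Proof.
move=> g; have := span_graph_hdot g g; rewrite !hdot_norm => /complexI /eqP.
by rewrite eqrXn2 // => /eqP.
Qed.

Lemma closed_graph_norm x y : closed_graph x y -> `|y| = `|x|.
Proof.
move=> g; apply/eqP; rewrite -subr_eq0 -normr_le0; apply/ler_addgt0Pl => e e0.
rewrite addr0; have e2 : 0 < e / 2 by rewrite divr_gt0.
have [x1 [y1 [G X Y]]] := g _ e2.
rewrite (_ : `|y| - `|x| = (`|y| - `|y1|) + (`|x1| - `|x|)); last first.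
  by rewrite (span_graph_norm G); ring.
rewrite [leRHS](splitr e); apply: le_trans (ler_normD _ _) _; apply: lerD.
  exact: le_trans (ler_dist_dist _ _) (ltW Y).
by rewrite distrC; exact: le_trans (ler_dist_dist _ _) (ltW X).
Qed.

Lemma closed_graph_hdot x y x' y' :
  closed_graph x y -> closed_graph x' y' -> hdot y y' = hdot x x'.
Proof.
have re x1 y1 x2 y2 : closed_graph x1 y1 -> closed_graph x2 y2 ->
    complex.Re (hdot y1 y2) = complex.Re (hdot x1 x2).
  move=> g1 g2; rewrite !rdot_polar (closed_graph_norm g1) (closed_graph_norm g2).
  by rewrite (closed_graph_norm (closed_graphD g1 g2)).
move=> g g'; apply: complex_eq; first exact: re.
by rewrite !hdot_Im; apply: re => //; exact: closed_graphZ.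
Qed.

Lemma closed_graph_fun x y y' : closed_graph x y -> closed_graph x y' -> y = y'.
Proof.
move=> g g'; have := closed_graphD g (closed_graphZ (-1) g').
rewrite !hscaleN1 => /closed_graph_norm; rewrite subrr normr0 => /eqP.
by rewrite normr_eq0 subr_eq0 => /eqP.
Qed.

(** Approximants of [x] in the span have partners at the same mutual distances, so the partners form
    a Cauchy sequence and converge by completeness of [H']. *)
Lemma closed_graph_exists x :
  closed_span (range u) x -> exists y, closed_graph x y.
Proof.
move=> cx; have appr n : exists xy : H * H',
    span_graph xy.1 xy.2 /\ `|x - xy.1| < n.+1%:R^-1.
  have [|x1 [sx1 xx1]] := cx (ball x n.+1%:R^-1); first exact: nbhsx_ballx.
  have [y1 g1] := span_graph_exists sx1; exists (x1, y1); split => //.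
  by move: xx1; rewrite -ball_normE.
have [s sP] := choice appr.
have dy n m : `|(s n).2 - (s m).2| = `|(s n).1 - (s m).1|.
  have := span_graphD (sP n).1 (span_graphZ (-1) (sP m).1).
  by rewrite !hscaleN1 => /span_graph_norm.
have small (e : R) : 0 < e -> \forall n \near \oo, n.+1%:R^-1 < e.
  by move=> e0; near=> n; near: n; exact: near_infty_natSinv_lt (PosNum e0).
have cy : cvgn (fun n => (s n).2).
  apply/cauchy_cvgP/cauchy_exP => e e0.
  have e2 : 0 < e / 2 by rewrite divr_gt0.
  have [N _ NP] := small _ e2; exists (s N).2.
  exists N => // n Nn; rewrite /= -ball_normE /= dy [e](splitr e).
  rewrite -(subrKA x); apply: le_lt_trans (ler_normD _ _) _; apply: ltrD.
    by rewrite distrC; apply: lt_trans (sP N).2 _; apply: NP => /=.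
  by apply: lt_trans (sP n).2 _; exact: NP.
exists (lim ((fun n => (s n).2) @ \oo)) => e e0.
have /cvgrPdist_lt/(_ e e0) ly := cy.
have [n [n1 n2]] : exists n, `|lim ((fun n => (s n).2) @ \oo) - (s n).2| < e
    /\ n.+1%:R^-1 < e.
  have [N _ NP] : \forall n \near \oo,
    `|lim ((fun n => (s n).2) @ \oo) - (s n).2| < e /\ n.+1%:R^-1 < e.
    by near=> n; split; near: n; [exact: ly|exact: small].
  by exists N; apply: NP => /=.
exists (s n).1, (s n).2; split => //; first exact: (sP n).1.
exact: lt_trans (sP n).2 n2.
Unshelve. all: by end_near. Qed.

End Graph.

Lemma span_graphC (H H' : hilbertType R) (u : T -> H) (v : T -> H') x y :
  span_graph u v x y -> span_graph v u y x.
Proof. by elim=> [|a t x1 y1 _ IH]; [exact: span_graph0|exact: span_graphS]. Qed.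

Lemma closed_graphC (H H' : hilbertType R) (u : T -> H) (v : T -> H') x y :
  closed_graph u v x y -> closed_graph v u y x.
Proof.
move=> g e e0; have [x1 [y1 [/span_graphC G X Y]]] := g e e0.
by exists y1, x1.
Qed.

Lemma gram_unitary_iso (H H' : hilbertType R) (u : T -> H) (v : T -> H') :
  (forall s t, hdot (v s) (v t) = hdot (u s) (u t)) ->
  exists W : H -> H', unitary_iso (closed_span (range u)) (closed_span (range v)) W
    /\ forall t, W (u t) = v t.
Proof.
move=> gram; have gram' s t : hdot (u s) (u t) = hdot (v s) (v t) by rewrite gram.
(* Off the closed span no partner exists and [xget] returns the default 0. *)
pose W x := xget 0 [set y | closed_graph u v x y].
have WP x y : closed_graph u v x y -> W x = y.
  move=> g; have : closed_graph u v x (W x) by rewrite /W; case: xgetP => // /(_ y).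
  by move=> /(closed_graph_fun gram); exact.
have Wg x : closed_span (range u) x -> closed_graph u v x (W x).
  by move=> /(closed_graph_exists gram)[y g]; rewrite (WP _ _ g).
exists W; split; last first.
  move=> t; apply: WP; apply: span_closed_graph.
  have := span_graphS 1 t (span_graph0 u v).
  by rewrite !hscale1 !addr0.
split.
(* Injectivity and surjectivity are uniqueness and existence for the graph with the two families
   exchanged. *)
- split.
  + by move=> x /Wg /closed_graphC /closed_graph_fst.
  + move=> x x'; rewrite !inE => /Wg/closed_graphC g /Wg/closed_graphC g' e.
    by apply: (closed_graph_fun gram') g _; rewrite e.
  + move=> y /(closed_graph_exists gram')[x /closed_graphC g].
    by exists x; [exact: closed_graph_fst g|exact: WP].
- by move=> x x' /Wg g /Wg g'; apply: WP; exact: closed_graphD.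
- by move=> a x /Wg g; apply: WP; exact: closed_graphZ.
- by move=> x x' /Wg g /Wg g'; exact: (closed_graph_hdot gram).
Qed.

Lemma complex_span_rescale (H : hilbertType R) (v v' : T -> H) (c : T -> R[i]) :
  (forall t, v t = hscale (c t) (v' t)) ->
  complex_span (range v) `<=` complex_span (range v').
Proof.
move=> vc x [n [a [f [fv ->]]]].
have [t tP] := choice (fun i => let: ex_intro2 t _ e := fv i in ex_intro _ t e).
exists n, (fun i => a i * c (t i)), (fun i => v' (t i)); split=> [i|].
  by exists (t i).
by apply: eq_bigr => i _; rewrite -tP vc hscaleA.
Qed.

(** The isometry is built onto the span of the rescaled family u' / lambda, which has to be
    identified with that of u'. *)
Lemma closed_span_rescale (H : hilbertType R) (v v' : T -> H) (c : T -> R[i]) :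
  (forall t, c t != 0) -> (forall t, v t = hscale (c t) (v' t)) ->
  closed_span (range v) = closed_span (range v').
Proof.
move=> c0 vc; congr closure; apply/seteqP; split.
  exact: complex_span_rescale vc.
apply: (complex_span_rescale (c := fun t => (c t)^-1)) => t.
by rewrite vc hscaleA mulVf // hscale1.
Qed.

End GramIsometry.

Theorem theorem1 (R : realType) (C : int) (J : 'M[R]_2)
    (H H' : hilbertType R) (u : R * R -> H) (u' : R * R -> H')
    (C_neq0 : C != 0) (J_complex : J *m J = - 1%:M)
    (band : bloch_band u) (band' : bloch_band u')
    (chern : chern_number u = C%:~R) (chern' : chern_number u' = C%:~R)
    (kahler : kahler_wrt u J) (kahler' : kahler_wrt u' J)
    (flat : geometrically_flat u) (flat' : geometrically_flat u') :
  exists (W : H -> H') (lambda : R * R -> R[i]),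
    [/\ unitary_iso (closed_span (range u)) (closed_span (range u')) W,
        csmooth lambda,
        forall k, lambda k != 0
      & forall k, u' k = hscale (lambda k) (W (u k))].
Proof.
have su := bloch_smooth band; have u0 := bloch_neq0 band.
have su' := bloch_smooth band'; have u0' := bloch_neq0 band'.
have tau_im := modulus_neq_conj J_complex.
have hol := hder_antiholomorphic su u0 J_complex kahler.
have hol' := hder_antiholomorphic su' u0' J_complex kahler'.
have overlap := flat_kahler_overlap su u0 J_complex kahler flat.
have overlap' := flat_kahler_overlap su' u0' J_complex kahler' flat'.
(* Both bands share tau and the Chern number, so [metric_chern] makes the exponents of the two
   Gaussians equal. *)
have same_metric : quantum_metric u' 0 0 0 = quantum_metric u 0 0 0.
  apply: (@complexI R); apply: (mulfI tau_im).
  rewrite (metric_chern su u0 J_complex kahler flat 0).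
  by rewrite (metric_chern su' u0' J_complex kahler' flat' 0) chern chern'.
rewrite same_metric in overlap'.
have E0 p q := expR_gt0 (- quantum_metric u 0 0 0
  * Normc.normc (zcoord (modulus J) p - zcoord (modulus J) q) ^+ 2).
have gram := gram_gauge tau_im su su' u0 u0' hol hol' E0 overlap overlap'.
have lambda0 := gauge_neq0 u0 u0' E0 overlap overlap'.
pose lambda := gauge u u'; pose v k := hscale (lambda k)^-1 (u' k).
have gram_v p q : hdot (v p) (v q) = hdot (u p) (u q).
  rewrite /v hdotZl hdotZr gram conjc_inv -/(lambda p) -/(lambda q).
  have cp : conjc (lambda p) != 0 by rewrite conjc_eq0; exact: lambda0.
  move: (conjc (lambda p)) cp (lambda q) (lambda0 q : lambda q != 0) => x x0 y y0.
  by field; rewrite y0 x0.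
have uv k : u' k = hscale (lambda k) (v k).
  by rewrite /v hscaleA mulfV ?hscale1 //; exact: lambda0.
have [W [isoW Wu]] := gram_unitary_iso gram_v.
exists W, lambda; split => //.
- by rewrite (closed_span_rescale lambda0 uv).
- exact: csmooth_gauge su su' u0 E0 overlap.
- by move=> k; rewrite Wu.
Qed.
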